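(* Let $\varepsilon>0$, $Q\in\mathbb{N}$ and $0<\Delta\le 1/2$; put $\tau=\Delta^{-1/2}$. For $\alpha\in\mathbb{R}$ let \[ P(\alpha)=\#\{(q,a)\in\mathbb{Z}^2:\ Q<q\le 2Q,\ (a,q)=1,\ |a/q^2-\alpha|\le\Delta\}. \] Suppose $\alpha=\frac{b}{r}+z$ with $r\in\mathbb{N}$, $r\le\tau$, $b\in\mathbb{Z}$, $(b,r)=1$, and $z=\frac{1}{kr^2}$ where $k\in\mathbb{Z}$ satisfies $\lceil r^{-1}\Delta^{-1/2}\rceil\le |k|\le \lceil r^{-2}\Delta^{-1}\rceil$. Then \[ P(\alpha)\ll\left(\frac{Q}{\Delta}\right)^{\varepsilon}\left(Q^{1/2}+Q\Delta^{1/4}+Q^3\Delta+\sqrt{r}+Q^{3/2}\Delta^{1/2}r^{1/4}+Q^2\Delta r\right), \] where the implied constant depends on $\varepsilon$ alone.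
   Context: $\lceil x\rceil$ denotes the least integer $\ge x$. *)

(* Defs.v *)
From HB Require Import structures.
From mathcomp Require Import all_boot all_order all_algebra finmap.
From mathcomp Require Import all_classical all_reals all_analysis.

Set Implicit Arguments.
Unset Strict Implicit.
Unset Printing Implicit Defensive.

Import Order.TTheory GRing.Theory Num.Theory.

Local Open Scope classical_set_scope.
Local Open Scope ring_scope.

Definition square_fractions (R : realType) (Q : nat) (Delta alpha : R) :
    set (int * int) :=
  [set qa | [/\ (Q%:Z < qa.1 <= 2 * Q%:Z),
                coprimez qa.2 qa.1 &
                `| qa.2%:~R / qa.1%:~R ^+ 2 - alpha | <= Delta]].

(* [fset_set] sends infinite sets to the empty set; this shows that the
   default value is never used in [P_count]. *)
Lemma finite_square_fractions (R : realType) (Q : nat) (Delta alpha : R) :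
  finite_set (square_fractions Q Delta alpha).
Proof.
pose B : R := (`|alpha| + `|Delta|) * (2 * Q)%:R ^+ 2.
pose S M : set int := (Posz @` `I_M) `|` ((fun n => - n%:Z) @` `I_M).
have finS M : finite_set (S M).
  by rewrite finite_setU; split; apply: finite_image; exact: finite_II.
have inS M (a : int) : (`|a| < M)%N -> S M a.
  move=> aM; have [a0|a0] := leP 0 a.
    by left; exists `|a|%N => //=; rewrite gez0_abs.
  by right; exists `|a|%N => //=; rewrite ltz0_abs// opprK.
apply: (@sub_finite_set _ _ (S (2 * Q).+1 `*` S (Num.truncn B).+1)); last first.
  exact: finite_setX.
move=> [q a] [/= /andP[Qq qQ] _ aq].
have q0 : 0 < q by exact: le_lt_trans Qq.
have q0R : 0 < q%:~R :> R by rewrite ltr0z.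
have qQR : q%:~R <= (2 * Q)%:R :> R.
  by rewrite -[leRHS]/((2 * Q)%:Z%:~R) ler_int PoszM.
split => /=; apply: inS.
  by rewrite ltnS -lez_nat gez0_abs ?PoszM// ltW.
have aB : `|a%:~R| <= B :> R.
  have -> : a%:~R = (a%:~R / q%:~R ^+ 2) * q%:~R ^+ 2 :> R.
    by rewrite divfK// expf_neq0// gt_eqF.
  rewrite normrM; apply: ler_pM => //.
    rewrite -[X in `|X| <= _](subrK alpha) addrC.
    apply: le_trans (ler_normD _ _) _; rewrite lerD2l.
    exact: le_trans aq (ler_norm _).
  rewrite normrX ger0_norm; last exact: ltW.
  by apply: lerXn2r; rewrite ?nnegrE ?(ltW q0R)// ler0n.
rewrite -(ltr_nat R); apply: le_lt_trans (truncnS_gt _).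
by rewrite natr_absz intr_norm.
Qed.

Definition P_count (R : realType) (Q : nat) (Delta alpha : R) : nat :=
  #|` fset_set (square_fractions Q Delta alpha) |%fset.

(* Main.v *)
(* Write [v = |k| r] and [alpha = b/r + 1/(k r^2)]; in every case
   [P(alpha) << (Q/Delta)^eps (Q^(1/2) + Q^3 Delta)].

   If [Q^2 Delta >> 1], each [q] admits [O(Q^2 Delta)] numerators.

   If [Q Delta v >= 1], put [ell = a r - b q^2], an integer within
   [4 Q^2 Delta r] of [q^2/(k r)]. If [ell = 0] then [q^2 = r] by coprimality.
   For each other value of [ell] the admissible [q] lie in an interval of length
   [O(Q Delta r v)] and solve a quadratic congruence modulo [r], which has few
   solutions on average over [ell].

   If [Q Delta v < 1] and [Q^2 Delta] is small, let [H] be about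
   [1/(32 Q^2 Delta)]. By the Fejer kernel [P(alpha)] is at most [4 Q/H] plus the
   mean over [0 < h < H] of [8 |S(h)|], where [S(h) = sum_q e(h alpha q^2)].
   Weyl differencing and the divisor bound reduce [sum_h |S(h)|^2] to
   [sum_(n <= 2HQ) min(Q, 1/||alpha n||)], and the points [alpha n] of a block of
   [v/2] consecutive [n] are [1/(2v)]-separated modulo 1. *)
Require Import Defs.
From HB Require Import structures.
From mathcomp Require Import all_boot all_order all_algebra finmap.
From mathcomp Require Import all_classical all_reals all_analysis.
From mathcomp Require Import zify ring lra.

Set Implicit Arguments.
Unset Strict Implicit.
Unset Printing Implicit Defensive.

Import Order.TTheory GRing.Theory Num.Theory.

Local Open Scope ring_scope.

(** * The divisor bound *)

(** A divisor [d] of [m * n] is recovered from the pair [gcdn d m], [d %/ gcdn d m]. The second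
    entry divides [n] because it is coprime to [m %/ gcdn d m]. *)
Lemma size_divisorsM m n : (0 < m)%N -> (0 < n)%N ->
  (size (divisors (m * n)) <= size (divisors m) * size (divisors n))%N.
Proof.
move=> m0 n0; pose f d := (gcdn d m, d %/ gcdn d m)%N.
rewrite -[leqLHS](size_map f) -(size_allpairs pair).
apply: uniq_leq_size => [|x /mapP[d dmn ->{x}]].
  rewrite map_inj_uniq ?divisors_uniq// => d d' [gE qE].
  by rewrite -(divnK (dvdn_gcdl d m)) qE gE divnK// dvdn_gcdl.
move: dmn; rewrite -dvdn_divisors ?muln_gt0 ?m0// => dmn.
have d0 : (0 < d)%N by move: dmn; case: (d) => //; rewrite dvd0n; lia.
have g0 : (0 < gcdn d m)%N by rewrite gcdn_gt0 d0.
apply: allpairs_f; rewrite -dvdn_divisors// ?dvdn_gcdr//.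
have cop : coprime (d %/ gcdn d m) (m %/ gcdn d m).
  rewrite /coprime -(eqn_pmul2r g0) muln_gcdl mul1n.
  by rewrite !divnK ?dvdn_gcdl ?dvdn_gcdr.
rewrite -(Gauss_dvdr _ cop) -(dvdn_pmul2r g0) divnK ?dvdn_gcdl//.
by rewrite mulnAC divnK ?dvdn_gcdr.
Qed.

Lemma size_divisors_pfactor p e :
  prime p -> (size (divisors (p ^ e)) <= e.+1)%N.
Proof.
move=> pp; rewrite -[leqRHS](size_iota 0) -[leqRHS](size_map (fun i => p ^ i)%N).
apply: uniq_leq_size; first exact: divisors_uniq.
move=> d; rewrite -dvdn_divisors ?expn_gt0 ?prime_gt0//.
move=> /(dvdn_pfactor _ _ pp)[i ie ->].
by apply: map_f; rewrite mem_iota.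
Qed.

Lemma size_divisors_prod (s : seq nat) (f : nat -> nat) :
  (forall p, 0 < f p)%N ->
  (size (divisors (\prod_(p <- s) f p)) <= \prod_(p <- s) size (divisors (f p)))%N.
Proof.
move=> f0; elim: s => [|p s IH]; first by rewrite !big_nil.
rewrite !big_cons; apply: leq_trans (size_divisorsM _ _) _ => //.
  by rewrite prodn_gt0.
by rewrite leq_mul2l IH orbT.
Qed.

Lemma size_divisors_logn n : (0 < n)%N ->
  (size (divisors n) <= \prod_(0 <= p < n.+1) (logn p n).+1)%N.
Proof.
move=> n0; rewrite -{1}(partnT n0) /partn.
rewrite (eq_bigl xpredT)//.
apply: leq_trans (size_divisors_prod _ (fun p => pfactor_gt0 p n)) _.
apply: leq_prod => p _.
(* The product runs over all [p], not only primes; a non-prime has [logn p n = 0] and contributes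
   the factor 1. *)
case: (boolP (prime p)) => [|np]; first exact: size_divisors_pfactor.
by rewrite lognE (negbTE np).
Qed.

Lemma prod_le_exp (R : realType) (K : R) (P N : nat) : 1 <= K ->
  \prod_(0 <= p < N) (if (p < P)%N then K else 1) <= K ^+ P.
Proof.
move=> K1; have -> : K ^+ P = \prod_(0 <= p < P) K.
  by rewrite prodr_const_nat subn0.
have K0 : 0 <= K by lra.
have [NP|PN] := leqP N P.
  rewrite [leRHS](@big_cat_nat _ _ _ N)//= -[leLHS]mulr1.
  apply: ler_pM; rewrite ?ler01 ?prodr_ge0//.
  - by move=> p _; case: ifP.
  - by apply: ler_prod => p _; case: ifP; rewrite ?lexx ?ler01 ?K0.
  - by apply: (big_ind (fun x => 1 <= x)) => // x y; exact: mulr_ege1.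
rewrite (@big_cat_nat _ _ _ P) ?(ltnW PN)//=.
rewrite [X in _ * X <= _](_ : _ = 1) ?mulr1.
  by rewrite le_eqVlt; apply/orP; left; apply/eqP; apply: eq_big_nat => p /andP[_ ->].
rewrite big_nat_cond big1// => p /andP[/andP[Pp _] _]; by rewrite ltnNge Pp.
Qed.

(* In [n^eps = \prod_p (p^eps)^(e_p)] a prime with [p^eps >= 2] absorbs its own
   factor [e_p + 1]; each of the boundedly many other primes costs at most [K]. *)
Lemma divisor_bound (R : realType) (eps : R) : 0 < eps ->
  exists2 C : R, 0 < C &
    forall n, (0 < n)%N -> (size (divisors n))%:R <= C * n%:R `^ eps.
Proof.
(* [P] exceeds [2^(1/eps)], so every [p >= P] has [p^eps >= 2]. *)
move=> e0; pose P := (Num.truncn ((2 : R) `^ eps^-1)).+1.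
pose K : R := 1 + (eps * ln 2)^-1.
have ln20 : 0 < ln 2 :> R by rewrite ln_gt0// ltr1n.
have eln : 0 < eps * ln 2 by rewrite mulr_gt0.
have K1 : 1 <= K by rewrite lerDl invr_ge0 ltW.
exists (K ^+ P); first by rewrite exprn_gt0; lra.
move=> n n0.
have main p (e := logn p n) : e.+1%:R <=
    (if (p < P)%N then K else 1) * ((p ^ e)%N%:R : R) `^ eps.
  have [e00|epos] := posnP e.
    rewrite e00 expn0 powR1 mulr1; case: ifP => //.
  have p2 : (2 <= p)%N.
    by move: epos; rewrite /e lognE; case: ifP => // /and3P[/prime_gt1].
  have pR : 2 <= p%:R :> R by rewrite (ler_nat R 2).
  have -> : ((p ^ e)%N%:R : R) `^ eps = (p%:R `^ eps) ^+ e.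
    by rewrite natrX -powR_mulrn// -powRrM mulrC powRrM powR_mulrn ?powR_ge0.
  case: ifPn => [_|].
    (* This is [1 + x <= exp x] together with [p >= 2]. Since [K] contains [1 / (eps ln 2)],
       multiplying by [K] turns the left side into at least [e + 1]. *)
    have : (1 + e%:R * (eps * ln 2)) <= (p%:R `^ eps) ^+ e.
      have -> : (p%:R `^ eps) ^+ e = expR (e%:R * (eps * ln p%:R)).
        by rewrite /powR pnatr_eq0; case: (p) p2 => // p' _ /=; rewrite -expRM_natl.
      apply: le_trans (expR_ge1Dx _) _; rewrite ler_expR.
      rewrite ler_pM2l ?ltr0n// ler_pM2l//.
      by rewrite ler_ln ?posrE; lra.
    move/(ler_wpM2l (le_trans ler01 K1)); apply: le_trans.
    have -> : K * (1 + e%:R * (eps * ln 2)) =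
        1 + (eps * ln 2)^-1 + e%:R * (eps * ln 2) + e%:R.
      by rewrite /K; field; rewrite !gt_eqF.
    have : 0 <= e%:R * (eps * ln 2) by rewrite mulr_ge0// ltW.
    have : 0 <= (eps * ln 2)^-1 by rewrite invr_ge0 ltW.
    by rewrite -natr1; lra.
  rewrite -leqNgt => Pp; rewrite mul1r.
  have pe2 : 2 <= p%:R `^ eps :> R.
    rewrite -[leLHS]powRr1// -[X in _ `^ X](@mulVf _ eps) ?gt_eqF// powRrM.
    apply: ge0_ler_powR; rewrite ?nnegrE ?powR_ge0 ?(ltW e0)//.
    apply: le_trans (ltW (truncnS_gt _)) _; by rewrite ler_nat.
  (* A large prime needs no constant: [e + 1 <= 2^e <= (p^eps)^e]. *)
  apply: le_trans (_ : 2 ^+ e <= _).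
    by rewrite -natrX ler_nat; apply: ltn_expl.
  by apply: lerXn2r; rewrite // ?nnegrE ?powR_ge0.
apply: le_trans (_ : (\prod_(0 <= p < n.+1) (logn p n).+1)%N%:R <= _).
  by rewrite ler_nat size_divisors_logn.
rewrite natr_prod; apply: le_trans (_ : \prod_(0 <= p < n.+1)
   ((if (p < P)%N then K else 1) * ((p ^ logn p n)%N%:R : R) `^ eps) <= _).
  by apply: ler_prod => p _; rewrite ler0n main.
rewrite big_split/=.
have -> : \prod_(0 <= p < n.+1) (((p ^ logn p n)%N%:R : R) `^ eps) = n%:R `^ eps.
  rewrite -[in RHS](partnT n0) /partn (eq_bigl xpredT)// natr_prod.
  elim: (index_iota _ _) => [|p s IH]; first by rewrite !big_nil powR1.
  by rewrite !big_cons powRM ?prodr_ge0// IH.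
by apply: ler_wpM2r; rewrite ?powR_ge0//; exact: prod_le_exp.
Qed.

(** * Cosine sums *)

(** If [0 <= cos y < 1/2], then [cos 2y = 2 cos^2 y - 1] would be negative. *)
Lemma half_le_cos_of_double (R : realType) (y : R) :
  0 <= cos y -> 0 <= cos (y *+ 2) -> 1 / 2 <= cos y.
Proof.
rewrite cos_mulr2n -[cos y ^+ 2 *+ 2]mulr_natr => h1 h2.
rewrite leNgt; apply/negP => h3.
have a1 : 0 < 1 / 2 - cos y by lra.
have a2 : 0 < 1 / 2 + cos y by lra.
have := mulr_gt0 a1 a2; lra.
Qed.

(** The induction step is [1/(n+1) <= -ln (1 - 1/(n+1)) = ln ((n+1)/n)]. *)
Lemma sum_inv_le_ln (R : realType) n :
  \sum_(1 <= c < n.+1) (c%:R : R)^-1 <= 1 + ln n%:R.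
Proof.
case: n => [|n]; first by rewrite big_geq// ln0// addr0 ler01.
elim: n => [|n IH]; first by rewrite big_nat1 invr1 ln1 addr0.
rewrite big_nat_recr//=.
suff h : (n.+2%:R : R)^-1 <= ln n.+2%:R - ln n.+1%:R.
  by apply: le_trans (lerD IH h) _; rewrite -addrA subrKC.
rewrite -ln_div ?posrE//.
have n10 : 0 < n.+1%:R :> R by rewrite ltr0n.
have -> : (n.+2%:R / n.+1%:R : R) = (1 + - (n.+2%:R)^-1)^-1.
  by rewrite -[n.+2%:R]natr1; field; apply/andP; split; lra.
have n2 : (n.+2%:R : R)^-1 < 1 by rewrite invf_lt1 ?ltr1n.
rewrite lnV ?posrE; last by rewrite subr_gt0.
by rewrite lerNr; apply: le_ln1Dx; rewrite ltrN2.
Qed.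

(** Logarithms are absorbed into the factor [X^eps]; the inequality is [1 + y <= exp y] at
    [y = eps ln x]. *)
Lemma one_plus_ln_le_powR (R : realType) (eps x : R) : 0 < eps -> 1 <= x ->
  1 + ln x <= (1 + eps^-1) * x `^ eps.
Proof.
move=> e0 x1; have x0 : 0 < x by lra.
have h1 : 1 + eps * ln x <= x `^ eps.
  by rewrite /powR gt_eqF// expR_ge1Dx.
have l0 := ln_ge0 x1.
have ei : 0 < eps^-1 by rewrite invr_gt0.
have h2 := ler_wpM2l (ltW ei) h1.
rewrite mulrDr mulr1 mulrA mulVf ?gt_eqF// mul1r in h2.
have h3 : 0 <= eps * ln x by rewrite mulr_ge0// ltW.
by rewrite mulrDl mul1r; lra.
Qed.

(** On [[0, pi/4]] the function [sin y - y/2] has derivative [cos y - 1/2 >= 0]. Beyond [pi/4] the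
    sine increases and already exceeds [1/4], while [x/2 <= 1/4]. *)
Lemma half_le_sin (R : realType) (x : R) : 0 <= x -> x <= 1 / 2 -> x / 2 <= sin (pi * x).
Proof.
move=> x0 x12.
have pi2 := @pi_ge2 R.
have pi4 : pi < 4 :> R by have := @pihalf_lt2 R; lra.
have sin_c (y : R) : 0 <= y -> y <= pi / 4 -> y / 2 <= sin y.
  move=> y0 y4; rewrite -subr_ge0.
  have cosq (z : R) : z \in `]0, y[ -> 0 <= cos z - 1/2.
    rewrite in_itv/= => /andP[z0 zy].
    have h2 : 0 <= cos (z *+ 2).
      by apply: cos_ge0_pihalf; rewrite [z *+ 2]mulr2n; apply/andP; split; lra.
    have h1 : 0 <= cos z by apply: cos_ge0_pihalf; apply/andP; split; lra.
    by rewrite subr_ge0; apply: half_le_cos_of_double.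
  have der (z : R) : is_derive z 1 (fun t : R => sin t - t * (1/2)) (cos z - 1 / 2).
    apply: is_derive_eq.
    by rewrite scaler0 add0r /GRing.scale/= mulr1.
  have : (fun t : R => sin t - t * (1/2)) 0 <= (fun t : R => sin t - t * (1/2)) y.
    apply: (@ger0_derive1_le_cc R (fun t : R => sin t - t * (1/2)) 0 y _ _ _ 0 y) => //.
    - by move=> z zi; rewrite derive1E derive_val; exact: cosq.
    - by apply: derivable_within_continuous => z _; exact: ex_derive.
    - by rewrite in_itv/= lexx.
    - by rewrite in_itv/= lexx y0.
  by rewrite /= sin0 mul0r subr0 mul1r.
have p0 : 0 <= pi * x by rewrite mulr_ge0//; lra.
have [px|px] := leP (pi * x) (pi / 4).
  apply: le_trans (sin_c _ p0 px).
  have : 2 * x <= pi * x by rewrite ler_wpM2r.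
  by lra.
have h4 : 1 / 4 <= sin (pi / 4) :> R.
  have : pi / 4 / 2 <= sin (pi / 4) :> R by apply: sin_c; lra.
  by lra.
have : sin (pi / 4) < sin (pi * x) :> R.
  have pxh : pi * x <= pi * (1 / 2) by rewrite ler_wpM2l//; lra.
  by rewrite ltr_sin// in_itv/=; apply/andP; split; lra.
by lra.
Qed.

Lemma cos_ge_half (R : realType) (x : R) : `|x| <= 1 / 8 -> 1 / 2 <= cos (2 * pi * x).
Proof.
move=> x8; rewrite -cos_norm normrM ger0_norm; last by rewrite mulr_ge0 ?pi_ge0.
have pi2 := @pi_ge2 R.
set y := 2 * pi * _.
have y0 : 0 <= y by rewrite /y !mulr_ge0 ?pi_ge0.
have y1 : y <= pi / 4.
  have : 2 * pi * `|x| <= 2 * pi * (1 / 8) by rewrite ler_wpM2l//; lra.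
  by rewrite /y; lra.
have h2 : 0 <= cos (y *+ 2).
  by apply: cos_ge0_pihalf; rewrite [y *+ 2]mulr2n; apply/andP; split; lra.
have h1 : 0 <= cos y by apply: cos_ge0_pihalf; apply/andP; split; lra.
exact: half_le_cos_of_double.
Qed.

Lemma cosD2pin (R : realType) (x : R) (m : int) : cos (x + 2 * pi * m%:~R) = cos x.
Proof.
have P (n : nat) y : cos (y + 2 * pi * n%:R) = cos y :> R.
  have -> : 2 * pi * n%:R = (pi *+ 2) *+ n :> R.
    by rewrite -[_ *+ n]mulr_natr -[pi *+ 2]mulr_natr; ring.
  exact: (periodicn (@cosD2pi R)).
case: m => n; first exact: P.
by rewrite NegzE mulrNz mulrN -{2}[x](subrK (2 * pi * n.+1%:R)) P.
Qed.

(* Telescoping: [2 sin(g/2) cos(b+ig) = sin(b+(i+1/2)g) - sin(b+(i-1/2)g)]. *)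
Lemma cos_arith_sum (R : realType) (n : nat) (b g : R) :
  `|\sum_(i < n) cos (b + i%:R * g)| * `|sin (g / 2)| <= 1.
Proof.
have tel : (\sum_(i < n) cos (b + i%:R * g)) * (2 * sin (g / 2)) =
   sin (b + n%:R * g - g / 2) - sin (b - g / 2).
  elim: n => [|n IH]; first by rewrite big_ord0 !mul0r addr0 subrr.
  rewrite big_ord_recr/= mulrDl IH.
  have -> : b + n.+1%:R * g - g / 2 = (b + n%:R * g) + g / 2.
    by rewrite -natr1; field.
  rewrite (sinD (b + n%:R * g) (g / 2)) (sinB (b + n%:R * g) (g / 2)); ring.
rewrite -normrM; have := congr1 Num.norm tel.
rewrite mulrCA; set S := _ * sin (g / 2); rewrite [in LHS]normrM (@ger0_norm _ 2)// => h.
have := ler_normB (sin (b + n%:R * g - g / 2)) (sin (b - g / 2)).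
have := sin_max (b + n%:R * g - g / 2); have := sin_max (b - g / 2).
by lra.
Qed.

(** The square is cut into its diagonal and the pairs at distance [d], which is the rearrangement
    behind Weyl differencing. *)
Lemma sum_triangle (R : zmodType) (n : nat) (F : nat -> nat -> R) :
  \sum_(i < n) \sum_(j < n) F i j =
  \sum_(i < n) F i i +
  \sum_(1 <= d < n) \sum_(j < n - d) (F (j + d)%N j + F j (j + d)%N).
Proof.
elim: n => [|n IH]; first by rewrite !big_ord0 big_geq// addr0.
rewrite big_ord_recr/= (eq_bigr (fun i : 'I_n => \sum_(j < n) F i j + F i n)); last first.
  by move=> i _; rewrite big_ord_recr.
rewrite big_split/= IH [X in _ + X]big_ord_recr [in RHS]big_ord_recr/=.
have -> : \sum_(1 <= d < n.+1) \sum_(j < n.+1 - d) (F (j + d)%N j + F j (j + d)%N) =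
  \sum_(1 <= d < n) \sum_(j < n - d) (F (j + d)%N j + F j (j + d)%N) +
  \sum_(j < n) (F n j + F j n).
  rewrite (@eq_big_nat _ _ _ 1 n.+1 _ (fun d =>
    \sum_(j < n - d) (F (j + d)%N j + F j (j + d)%N) +
    (F n (n - d)%N + F (n - d)%N n))); last first.
    move=> d /andP[d1 dn]; rewrite subSn// big_ord_recr/= subnK//.
  rewrite big_split/=; congr (_ + _).
    case: n {IH} => [|n]; first by rewrite !big_geq.
    by rewrite big_nat_recr//= subnn big_ord0 addr0.
  rewrite -(big_mkord xpredT (fun j => F n j + F j n)) big_nat_rev/= big_add1/=.
  by apply: eq_big_nat => i /andP[_ ni]; rewrite add1n subSS; congr (F _ _ + F _ _); lia.
rewrite big_split/= -!addrA; congr (_ + _).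
rewrite [RHS]addrCA; congr (_ + _).
rewrite addrA [LHS]addrC; congr (_ + _); exact: addrC.
Qed.

(** The real form of [|sum_i e^(i x_i)|^2] expanded by differences. It serves both the Fejer kernel
    and Weyl differencing. *)
Lemma sqr_cos_sin_sum (R : realType) (n : nat) (x : nat -> R) :
  (\sum_(i < n) cos (x i)) ^+ 2 + (\sum_(i < n) sin (x i)) ^+ 2 =
  n%:R + 2 * \sum_(1 <= d < n) \sum_(j < n - d) cos (x (j + d)%N - x j).
Proof.
have -> : (\sum_(i < n) cos (x i)) ^+ 2 + (\sum_(i < n) sin (x i)) ^+ 2 =
   \sum_(i < n) \sum_(j < n) cos (x i - x j).
  rewrite !expr2 !mulr_suml -big_split/=; apply: eq_bigr => i _.
  by rewrite !mulr_sumr -big_split/=; apply: eq_bigr => j _; rewrite cosB.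
rewrite (sum_triangle n (fun i j => cos (x i - x j))); congr (_ + _).
  rewrite (eq_bigr (fun=> 1)); last by move=> i _; rewrite subrr cos0.
  by rewrite sumr_const card_ord.
rewrite mulr_sumr; apply: eq_bigr => d _; rewrite mulr_sumr; apply: eq_bigr => j _.
by rewrite -[in X in _ + X]opprB cosN; ring.
Qed.

(** The index of the interval [[c/B, (c+1)/B)] that contains the fractional part of [x]. *)
Definition cell (R : realType) (B : nat) (x : R) : nat :=
  Num.truncn ((x - (Num.floor x)%:~R) * B%:R).

Lemma cell_bounds (R : realType) (B : nat) (x : R) : (0 < B)%N ->
  let f := x - (Num.floor x)%:~R in
  [/\ (cell B x < B)%N, (cell B x)%:R / B%:R <= f & f < (cell B x).+1%:R / B%:R].
Proof.
move=> B0 f; have BR : 0 < B%:R :> R by rewrite ltr0n.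
have /andP[h1 h2] := floor_itv x.
have f0 : 0 <= f by rewrite /f; lra.
have f1 : f < 1 by rewrite intrD in h2; rewrite /f; lra.
have fB0 : 0 <= f * B%:R by rewrite mulr_ge0// ltW.
have /andP[t1 t2] := truncn_itv fB0.
split; [|by rewrite ler_pdivrMr|by rewrite ltr_pdivlMr].
rewrite -(ltr_nat R); apply: le_lt_trans t1 _.
by rewrite gtr_pMl.
Qed.

(* Majorant of a cosine sum of length at most [Q] whose frequency lies at
   distance at least [c / B] from the integers. *)
Definition cellw (R : realType) (Q B c : nat) : R :=
  if c is 0 then Q%:R else 2 * B%:R / c%:R.

Lemma cellw_ge0 (R : realType) (Q B c : nat) : 0 <= cellw R Q B c.
Proof. by case: c => [|c] /=; rewrite ?ler0n// divr_ge0// mulr_ge0. Qed.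

(** The first majorant serves frequencies just above an integer, the second those just below; each
    is nonnegative, so their sum covers both cases. *)
Lemma cos_sum_cellw (R : realType) (Q B n : nat) (b x : R) :
  (0 < B)%N -> (n <= Q)%N ->
  `|\sum_(i < n) cos (b + i%:R * (2 * pi * x))| <=
  cellw R Q B (cell B x) + cellw R Q B (B.-1 - cell B x).
Proof.
move=> B0 nQ; have [cB c1 c2] := cell_bounds x B0.
set c := cell B x in cB c1 c2 *; set f := x - _ in c1 c2.
have BR : 0 < B%:R :> R by rewrite ltr0n.
set S := \sum_(i < n) _.
have triv : `|S| <= Q%:R.
  apply: le_trans (ler_norm_sum _ _ _) _.
  apply: le_trans (_ : \sum_(i < n) 1 <= _); last by rewrite sumr_const card_ord ler_nat.
  by apply: ler_sum => i _; exact: cos_max.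
have /andP[h1 h2] := floor_itv x.
have f0 : 0 <= f by rewrite /f; lra.
have f1 : f < 1 by rewrite intrD in h2; rewrite /f; lra.
have tel : `|S| * `|sin (pi * f)| <= 1.
  (* By periodicity the frequency may be replaced by its fractional part [f]. *)
  have -> : S = \sum_(i < n) cos (b + i%:R * (2 * pi * f)).
    apply: eq_bigr => i _.
    have -> : b + i%:R * (2 * pi * x) =
      b + i%:R * (2 * pi * f) + 2 * pi * (i%:Z * Num.floor x)%:~R.
      by rewrite intrM /f; ring.
    by rewrite cosD2pin.
  have -> : pi * f = (2 * pi * f) / 2 by field.
  exact: cos_arith_sum.
have key (d : nat) (u : R) : d%:R / B%:R <= u -> u / 2 <= `|sin (pi * f)| ->
    `|S| <= cellw R Q B d.
  case: d => [//|d] du us /=.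
  have d0 : 0 < d.+1%:R :> R by rewrite ltr0n.
  rewrite ler_pdivlMr//.
  have : d.+1%:R / B%:R / 2 <= `|sin (pi * f)| by lra.
  move/(ler_wpM2l (normr_ge0 S)) => h.
  have := le_trans h tel.
  have -> : `|S| * (d.+1%:R / B%:R / 2) = `|S| * d.+1%:R / (2 * B%:R).
    by field; rewrite gt_eqF.
  by rewrite ler_pdivrMr ?mulr_gt0// mul1r.
have [fh|fh] := leP f (1 / 2).
  rewrite -[leLHS]addr0; apply: lerD; last exact: cellw_ge0.
  apply: (key _ f) => //; apply: le_trans (ler_norm _); exact: half_le_sin.
(* For [f > 1/2] the distance to the next integer is [1 - f], and [f < (c+1)/B] gives
   [1 - f >= (B-1-c)/B]. *)
rewrite -[leLHS]add0r; apply: lerD; first exact: cellw_ge0.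
apply: (key _ (1 - f)).
  rewrite natrB; last by rewrite -ltnS prednK.
  have -> : B.-1%:R = B%:R - 1 :> R by rewrite -[in RHS](prednK B0) -natr1 addrK.
  rewrite -natr1 ltr_pdivlMr// in c2.
  by rewrite ler_pdivrMr//; lra.
have -> : sin (pi * f) = sin (pi * (1 - f)).
  have -> : pi * (1 - f) = pi - pi * f by ring.
  by rewrite (sinB pi (pi * f)) sinpi cospi; ring.
apply: le_trans (ler_norm _); apply: half_le_sin; lra.
Qed.

Lemma sum_cellw (R : realType) (Q B : nat) :
  \sum_(c < B) (cellw R Q B c + cellw R Q B (B.-1 - c)) <=
  2 * Q%:R + 4 * B%:R * (1 + ln B%:R).
Proof.
case: B => [|B].
  by rewrite big_ord0 mulr0 mul0r addr0 mulr_ge0.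
have E : \sum_(c < B.+1) cellw R Q B.+1 c <= Q%:R + 2 * B.+1%:R * (1 + ln B.+1%:R).
  rewrite big_ord_recl/= lerD2l.
  have -> : \sum_(i < B) 2 * B.+1%:R / (lift ord0 i)%:R =
     2 * B.+1%:R * \sum_(1 <= c < B.+1) (c%:R : R)^-1.
    rewrite big_add1/= big_mkord mulr_sumr; apply: eq_bigr => i _.
    by rewrite /bump leq0n add1n.
  rewrite ler_wpM2l ?mulr_ge0//; apply: le_trans (sum_inv_le_ln R B) _.
  rewrite lerD2l; case: B => [|B]; first by rewrite ln0// ln1.
  by rewrite ler_ln ?posrE// ler_nat.
rewrite big_split/=.
have -> : \sum_(c < B.+1) cellw R Q B.+1 (B - c) = \sum_(c < B.+1) cellw R Q B.+1 c.
  rewrite (reindex_inj rev_ord_inj)/=; apply: eq_bigr => i _.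
  by congr cellw; have := ltn_ord i; lia.
by lra.
Qed.

(* Points that are pairwise [1 / B]-separated modulo 1 lie in distinct cells. *)
Lemma block_cellw (R : realType) (Q B L s : nat) (alpha : R) : (0 < B)%N ->
  (forall n (m : int), (0 < n < L)%N -> B%:R^-1 <= `|alpha * n%:R - m%:~R|) ->
  \sum_(i < L) (cellw R Q B (cell B (alpha * (s + i)%:R)) +
                cellw R Q B (B.-1 - cell B (alpha * (s + i)%:R))) <=
  2 * Q%:R + 4 * B%:R * (1 + ln B%:R).
Proof.
move=> B0 sep; apply: le_trans (sum_cellw R Q B).
pose c (i : 'I_L) : 'I_B :=
  Ordinal (let: And3 h _ _ := cell_bounds (alpha * (s + i)%:R) B0 in h).
have cinj : injective c.
  suff W (i j : 'I_L) : c i = c j -> (i <= j)%N.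
    by move=> i j cij; apply: val_inj; apply/eqP; rewrite eqn_leq !W.
  move=> /(congr1 val)/= cij; rewrite leqNgt; apply/negP => ji.
  have [_ a1 a2] := cell_bounds (alpha * (s + i)%:R) B0.
  have [_ b1 b2] := cell_bounds (alpha * (s + j)%:R) B0.
  rewrite cij in a1 a2; move: a1 a2 b1 b2.
  set fi := Num.floor _; set fj := Num.floor _ => a1 a2 b1 b2.
  have := sep (i - j)%N (fi - fj); rewrite subn_gt0 ji/= => /(_ _)/wrap[].
    by apply: leq_ltn_trans (leq_subr _ _) (ltn_ord i).
  apply/negP; rewrite -ltNge natrB ?(ltnW ji)// intrB.
  rewrite -natr1 mulrDl mul1r !natrD in a1 a2 b1 b2.
  by rewrite ltr_norml; apply/andP; split; lra.
pose g (k : 'I_B) := cellw R Q B k + cellw R Q B (B.-1 - k).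
(* By injectivity of [c] the block sums over a subset of the cells; the other cells only add
   nonnegative terms. *)
rewrite [leRHS](bigID (mem (c @: [set: 'I_L]%SET)))/= big_imset/=; last by move=> i j _ _; exact: cinj.
rewrite [X in _ <= X + _](eq_bigl xpredT); last by move=> i; rewrite inE.
by rewrite lerDl; apply: sumr_ge0 => i _; rewrite addr_ge0 ?cellw_ge0.
Qed.

Lemma sum_cellw_le (R : realType) (Q B L T : nat) (alpha : R) : (0 < B)%N ->
  (forall n (m : int), (0 < n < L)%N -> B%:R^-1 <= `|alpha * n%:R - m%:~R|) ->
  \sum_(i < T * L) (cellw R Q B (cell B (alpha * i%:R)) +
                cellw R Q B (B.-1 - cell B (alpha * i%:R))) <=
  T%:R * (2 * Q%:R + 4 * B%:R * (1 + ln B%:R)).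
Proof.
move=> B0 sep; elim: T => [|T IH]; first by rewrite mul0n big_ord0 mul0r.
rewrite -(big_mkord xpredT (fun i => cellw R Q B (cell B (alpha * i%:R)) +
                cellw R Q B (B.-1 - cell B (alpha * i%:R)))).
rewrite (@big_cat_nat _ _ _ (T * L))//=; last by rewrite leq_mul2r leqnSn orbT.
rewrite -natr1 mulrDl mul1r; apply: lerD; first by rewrite big_mkord.
rewrite -{1}[(T * L)%N]add0n big_addn mulSn addnK big_mkord.
apply: le_trans (block_cellw Q (T * L) B0 sep).
by rewrite le_eqVlt; apply/orP; left; apply/eqP/eq_bigr => i _; rewrite addnC.
Qed.

(** * Weyl differencing *)

Definition cosmaj (R : realType) (Q B : nat) (x : R) : R :=
  cellw R Q B (cell B x) + cellw R Q B (B.-1 - cell B x).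

Lemma cosmaj_ge0 (R : realType) (Q B : nat) (x : R) : 0 <= cosmaj Q B x.
Proof. by rewrite addr_ge0 ?cellw_ge0. Qed.

(** The real part of the Weyl sum of [e(h alpha q^2)] over [Q < q <= 2Q], with [q = Q + 1 + i]. *)
Definition sqcos (R : realType) (Q : nat) (alpha : R) (h : nat) : R :=
  \sum_(i < Q) cos (2 * pi * h%:R * (alpha * (Q.+1 + i)%:R ^+ 2)).

(** Adding the square of the sine sum gives the squared modulus. The phases at [q + d] and [q] then
    differ by a function linear in [q], of frequency [2 g d alpha]. *)
Lemma sqcos_sqr_le (R : realType) (Q B : nat) (alpha : R) (g : nat) : (0 < B)%N ->
  sqcos Q alpha g ^+ 2 <=
  Q%:R + 2 * \sum_(1 <= d < Q) cosmaj Q B (alpha * (2 * g * d)%:R).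
Proof.
move=> B0; pose x (i : nat) : R := 2 * pi * g%:R * (alpha * (Q.+1 + i)%:R ^+ 2).
have := sqr_cos_sin_sum Q x; rewrite -/(sqcos Q alpha g) => E.
have s0 : 0 <= (\sum_(i < Q) sin (x i)) ^+ 2 by exact: sqr_ge0.
apply: le_trans (_ : sqcos Q alpha g ^+ 2 + (\sum_(i < Q) sin (x i)) ^+ 2 <= _).
  by rewrite lerDl.
rewrite E lerD2l ler_wpM2l//; apply: ler_sum_nat => d /andP[d1 dQ].
pose b : R := 2 * pi * g%:R * (alpha * (2 * Q.+1%:R * d%:R + d%:R ^+ 2)).
apply: le_trans (ler_norm _) _.
rewrite (eq_bigr (fun i : 'I_(Q - d) =>
  cos (b + i%:R * (2 * pi * (alpha * (2 * g * d)%:R))))); last first.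
  by move=> j _; congr cos; rewrite /x /b !natrD !natrM; ring.
by apply: cos_sum_cellw; rewrite ?leq_subr.
Qed.

(** In [2 g d = i] the factor [g] divides [i] and determines [d]. For [i = 0] there is no solution
    because [g] and [d] start at 1. *)
Lemma count_products (H Q i : nat) :
  (\sum_(1 <= g < H) \sum_(1 <= d < Q) (2 * g * d == i) <=
     (0 < i) * size (divisors i))%N.
Proof.
case: i => [|i].
  rewrite mul0n leqn0 big_nat_cond; apply/eqP/big1 => g /andP[/andP[g1 _] _].
  rewrite big_nat_cond; apply: big1 => d /andP[/andP[d1 _] _].
  by apply/eqP; rewrite eqb0 -lt0n !muln_gt0 g1 d1.
rewrite mul1n; apply: (@leq_trans (\sum_(1 <= g < H) (g %| i.+1))).
  rewrite big_nat_cond [leqRHS]big_nat_cond; apply: leq_sum => g /andP[/andP[g1 _] _].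
  have [gi|gi] := boolP (g %| i.+1)%N; last first.
    rewrite leqn0; apply/eqP/big1 => d _; apply/eqP; rewrite eqb0.
    by apply: contra gi => /eqP <-; rewrite -mulnA mulnCA dvdn_mulr.
  apply: (@leq_trans (\sum_(1 <= d < Q) (d == i.+1 %/ (2 * g)))).
    apply: leq_sum => d _; have [E|//] := eqVneq (2 * g * d)%N i.+1.
    by rewrite -E mulKn ?eqxx// muln_gt0.
  rewrite (eq_bigr (fun d => if d == i.+1 %/ (2 * g) then 1 else 0)%N); last first.
    by move=> d _; case: eqP.
  by rewrite -big_mkcond sum1_count count_uniq_mem ?iota_uniq// leq_b1.
rewrite (eq_bigr (fun g => if (g %| i.+1)%N then 1 else 0)%N); last first.
  by move=> d _; case: (_ %| _)%N.
rewrite -big_mkcond sum1_count -size_filter; apply: uniq_leq_size.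
  by rewrite filter_uniq// iota_uniq.
by move=> g; rewrite mem_filter -dvdn_divisors// => /andP[].
Qed.

(** The double sum is regrouped by the value [2 g d], each value being taken at most [D] times. *)
Lemma sum_products (R : realType) (F : nat -> R) (H Q N : nat) (D : R) :
  (forall n, 0 <= F n) -> (2 * H * Q <= N)%N ->
  (forall n, (0 < n < N)%N -> (size (divisors n))%:R <= D) -> 0 <= D ->
  \sum_(1 <= g < H) \sum_(1 <= d < Q) F (2 * g * d)%N <= D * \sum_(i < N) F i.
Proof.
move=> F0 HQN tau D0.
have -> : \sum_(1 <= g < H) \sum_(1 <= d < Q) F (2 * g * d)%N =
  \sum_(i < N) (\sum_(1 <= g < H) \sum_(1 <= d < Q) (2 * g * d == i))%N%:R * F i.
  under [RHS]eq_bigr do rewrite natr_sum mulr_suml.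
  rewrite [RHS]exchange_big/=; apply: eq_big_nat => g /andP[g1 gH].
  under [RHS]eq_bigr do rewrite natr_sum mulr_suml.
  rewrite [RHS]exchange_big/=; apply: eq_big_nat => d /andP[d1 dQ].
  have lt : (2 * g * d < N)%N.
    by apply: leq_trans HQN; rewrite -!mulnA ltn_pmul2l//; apply: ltn_mul.
  rewrite (bigD1 (Ordinal lt))//= eqxx mul1r big1 ?addr0// => i.
  rewrite -val_eqE/= eq_sym => /negbTE ->; exact: mul0r.
rewrite mulr_sumr; apply: ler_sum => i _; rewrite ler_wpM2r//.
have := count_products H Q i; rewrite -(ler_nat R) => h; apply: le_trans h _.
have [->|i0] := posnP i; first by rewrite mul0n.
by rewrite mul1n; apply: tau; rewrite i0/=.
Qed.

(* The Fejer kernel detects the points close to an integer. *)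
Lemma fejer_count (R : realType) (Q H : nat) (alpha : R) (I : {set 'I_Q}) :
  (forall i, i \in I -> exists a : int,
     H%:R * `|alpha * (Q.+1 + i)%:R ^+ 2 - a%:~R| <= 1 / 8) ->
  #|I|%:R * (H%:R ^+ 2 / 4) <=
  H%:R * Q%:R + 2 * H%:R * \sum_(1 <= d < H) `|sqcos Q alpha d|.
Proof.
move=> near.
pose x (i : 'I_Q) (h : nat) : R := 2 * pi * h%:R * (alpha * (Q.+1 + i)%:R ^+ 2).
pose T i := (\sum_(h < H) cos (x i h)) ^+ 2 + (\sum_(h < H) sin (x i h)) ^+ 2.
have T0 i : 0 <= T i by rewrite addr_ge0 ?sqr_ge0.
have TI i : i \in I -> H%:R ^+ 2 / 4 <= T i.
  move=> /near[a ha]; rewrite /T -[leLHS]addr0; apply: lerD; last exact: sqr_ge0.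
  have -> : H%:R ^+ 2 / 4 = (H%:R / 2) ^+ 2 :> R by field.
  (* For a point near an integer every one of the [H] phases [h alpha q^2] stays within [1/8] of an
     integer, so every cosine is at least [1/2]. *)
  have le : H%:R / 2 <= \sum_(h < H) cos (x i h).
    apply: le_trans (_ : \sum_(h < H) (1 / 2) <= _).
      by rewrite sumr_const card_ord -[_ *+ H]mulr_natr; lra.
    apply: ler_sum => h _.
    have -> : x i h = 2 * pi * (h%:R * (alpha * (Q.+1 + i)%:R ^+ 2 - a%:~R)) +
        2 * pi * (h%:Z * a)%:~R.
      by rewrite /x intrM; ring.
    rewrite cosD2pin; apply: cos_ge_half.
    rewrite normrM ger0_norm//; apply: le_trans ha.
    by rewrite ler_wpM2r// ler_nat ltnW.
  by apply: lerXn2r; rewrite ?nnegrE ?divr_ge0//; apply: le_trans le; rewrite divr_ge0.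
apply: le_trans (_ : \sum_(i < Q) T i <= _).
  rewrite (bigID (mem I))/= -[leLHS]addr0; apply: lerD; last by apply: sumr_ge0.
  by rewrite mulr_natl -sumr_const; apply: ler_sum.
(* Here the triangular Fejer weights [H - d] appear: the difference of two phases depends on [d]
   alone. *)
rewrite (eq_bigr (fun i : 'I_Q => H%:R + 2 * \sum_(1 <= d < H)
    (H - d)%:R * cos (2 * pi * d%:R * (alpha * (Q.+1 + i)%:R ^+ 2)))); last first.
  move=> i _; rewrite /T (sqr_cos_sin_sum H (x i)); congr (_ + 2 * _); apply: eq_big_nat => d _.
  rewrite (eq_bigr (fun=> cos (2 * pi * d%:R * (alpha * (Q.+1 + i)%:R ^+ 2)))).
    by rewrite sumr_const card_ord -[_ *+ (H - d)]mulr_natl.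
  by move=> j _; congr cos; rewrite /x natrD; ring.
rewrite big_split/= sumr_const card_ord -[_ *+ Q]mulr_natr lerD2l -mulr_sumr.
rewrite -mulrA ler_wpM2l// exchange_big mulr_sumr/=; apply: ler_sum_nat => d _.
rewrite -mulr_sumr -/(sqcos Q alpha d).
apply: le_trans (ler_norm _) _; rewrite normrM ger0_norm//.
by rewrite ler_wpM2r// ler_nat leq_subr.
Qed.

(** [fejer_count] bounds the count by the first moment of the Weyl sums. The second moment is
    controlled by differencing, the divisor bound [D] and the [T] blocks of separated points. *)
Lemma weyl_count (R : realType) (Q H B L T : nat) (alpha D : R) (I : {set 'I_Q}) :
  (0 < H)%N -> (0 < B)%N -> (0 < Q)%N ->
  (forall i, i \in I -> exists a : int,
     H%:R * `|alpha * (Q.+1 + i)%:R ^+ 2 - a%:~R| <= 1 / 8) ->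
  (forall n (m : int), (0 < n < L)%N -> B%:R^-1 <= `|alpha * n%:R - m%:~R|) ->
  (2 * H * Q <= T * L)%N ->
  (forall n, (0 < n < T * L)%N -> (size (divisors n))%:R <= D) -> 0 <= D ->
  #|I|%:R <= 4 * Q%:R / H%:R + 8 * Num.sqrt (Q%:R +
    2 * D * T%:R * (2 * Q%:R + 4 * B%:R * (1 + ln B%:R)) / H%:R).
Proof.
move=> H0 B0 Q0 near sep HQT tau D0.
have HR : 0 < H%:R :> R by rewrite ltr0n.
have QR : 0 < Q%:R :> R by rewrite ltr0n.
set M := 2 * Q%:R + _; set Y := Q%:R + _.
have M0 : 0 <= M.
  rewrite /M addr_ge0 ?mulr_ge0// addr_ge0// ln_ge0// ler1n//.
have Y0 : 0 < Y.
  by rewrite /Y ltr_wpDr// divr_ge0// !mulr_ge0.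
have C2 : \sum_(1 <= d < H) sqcos Q alpha d ^+ 2 <= H%:R * Y.
  apply: le_trans (_ : \sum_(1 <= g < H) (Q%:R +
     2 * \sum_(1 <= d < Q) cosmaj Q B (alpha * (2 * g * d)%:R)) <= _).
    by apply: ler_sum_nat => g _; exact: sqcos_sqr_le.
  rewrite big_split/= -mulr_sumr.
  have -> : H%:R * Y = H%:R * Q%:R + 2 * (D * (T%:R * M)).
    by rewrite /Y; field; rewrite gt_eqF.
  apply: lerD.
    by rewrite sumr_const_nat -[_ *+ _]mulr_natl ler_wpM2r// ler_nat leq_subr.
  rewrite ler_wpM2l//.
  apply: le_trans (@sum_products R (fun n => cosmaj Q B (alpha * n%:R)) H Q (T * L) D _ HQT tau D0) _.
    by move=> n; exact: cosmaj_ge0.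
  by rewrite ler_wpM2l//; exact: sum_cellw_le.
set l := Num.sqrt Y.
have l0 : 0 < l by rewrite sqrtr_gt0.
have lY : l ^+ 2 = Y by rewrite sqr_sqrtr// ltW.
have C1 : \sum_(1 <= d < H) `|sqcos Q alpha d| <= H%:R * l.
  (* In place of Cauchy-Schwarz: [c <= l/2 + c^2/(2 l)], where [l^2 = Y] bounds the mean square and
     balances the two parts. *)
  apply: le_trans (_ : \sum_(1 <= d < H) (l / 2 + sqcos Q alpha d ^+ 2 / (2 * l)) <= _).
    apply: ler_sum_nat => d _; rewrite -[sqcos _ _ _ ^+ 2]real_normK ?num_real//.
    set c := `|_|; rewrite -subr_ge0.
    have -> : l / 2 + c ^+ 2 / (2 * l) - c = (l - c) ^+ 2 / (2 * l).
      by field; rewrite gt_eqF.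
    by rewrite divr_ge0 ?sqr_ge0// mulr_ge0// ltW.
  rewrite big_split/= -[X in _ + X <= _]mulr_suml.
  have a1 : \sum_(1 <= i < H) (l / 2) <= H%:R * (l / 2).
    rewrite sumr_const_nat -[_ *+ _]mulr_natl ler_wpM2r ?ler_nat ?leq_subr//.
    by rewrite divr_ge0// ltW.
  have a2 : (\sum_(1 <= i < H) sqcos Q alpha i ^+ 2) / (2 * l) <= H%:R * (l / 2).
    rewrite ler_pdivrMr ?mulr_gt0//; apply: le_trans C2 _.
    by rewrite -lY le_eqVlt; apply/orP; left; apply/eqP; field.
  by lra.
have := fejer_count near.
have H4 : 0 < H%:R ^+ 2 / 4 :> R by rewrite divr_gt0// exprn_gt0.
rewrite -ler_pdivlMr// => h; apply: le_trans h _.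
rewrite ler_pdivrMr//.
have -> : (4 * Q%:R / H%:R + 8 * l) * (H%:R ^+ 2 / 4) =
   H%:R * Q%:R + 2 * H%:R * (H%:R * l) by field; rewrite gt_eqF.
by rewrite lerD2l ler_wpM2l// mulr_ge0.
Qed.

(** * Counting fractions *)

Lemma square_fractions_seq (R : realType) (Q : nat) (Delta alpha : R) :
  exists s : seq (int * int), [/\ uniq s, size s = P_count Q Delta alpha &
    forall x, x \in s -> square_fractions Q Delta alpha x].
Proof.
exists (enum_fset (fset_set (square_fractions Q Delta alpha))); split => //.
  exact: fset_uniq.
move=> x; rewrite -[x \in _]/(x \in fset_set (square_fractions Q Delta alpha)).
by rewrite in_fset_set ?inE; last exact: finite_square_fractions.
Qed.

(** Since [Negz i] is [-(i+1)], the list covers the integers from [-(n+1)] to [n], which suits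
    offsets from a floor. *)
Definition zseq (n : nat) : seq int :=
  [seq Posz i | i <- iota 0 n.+1] ++ [seq Negz i | i <- iota 0 n.+1].

Lemma size_zseq n : size (zseq n) = (2 * n + 2)%N.
Proof. by rewrite size_cat !size_map !size_iota; lia. Qed.

Lemma mem_zseq n (z : int) : - (n.+1)%:Z <= z -> z <= n%:Z -> z \in zseq n.
Proof.
move=> z1 z2; rewrite mem_cat; apply/orP; case: z z1 z2 => m z1 z2; [left|right];
  by apply: map_f; rewrite mem_iota; lia.
Qed.

Definition nzseq (n : nat) : seq int :=
  [seq Posz i.+1 | i <- iota 0 n] ++ [seq Negz i | i <- iota 0 n].

Lemma size_nzseq n : size (nzseq n) = (2 * n)%N.
Proof. by rewrite size_cat !size_map !size_iota; lia. Qed.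

Lemma mem_nzseq n (z : int) : z != 0 -> (`|z| <= n)%N -> z \in nzseq n.
Proof.
move=> z0 zn; rewrite mem_cat; apply/orP; case: z z0 zn => [[|m]|m] // z0 zn; [left|right].
  by apply: (map_f (fun i => Posz i.+1)); rewrite mem_iota; lia.
by apply: map_f; rewrite mem_iota; lia.
Qed.

Lemma size_le_inj (T U : eqType) (f : T -> U) (s : seq T) (t : seq U) :
  uniq s -> {in s &, injective f} -> {in s, forall x, f x \in t} ->
  (size s <= size t)%N.
Proof.
move=> us fi st; rewrite -(size_map f); apply: uniq_leq_size.
  by rewrite map_inj_in_uniq.
by move=> y /mapP[x xs ->]; exact: st.
Qed.

Lemma size_le_sum_fibres (T U : eqType) (f : T -> U) (s : seq T) (t : seq U) :
  {in s, forall x, f x \in t} ->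
  (size s <= \sum_(d <- t) size [seq x <- s | f x == d])%N.
Proof.
elim: s => [//|x s IH] st.
have := IH (fun y ys => st y (@mem_behead _ (x :: s) y ys)).
rewrite -ltnS => /leq_trans; apply.
have xt := st x (mem_head _ _).
rewrite (big_rem (f x))//= [leqRHS](big_rem (f x))//= eqxx/= addSn ltnS leq_add2l.
by apply: leq_sum => d _; case: ifP => //= _; exact: leqnSn.
Qed.

Lemma den_bounds (R : realType) (Q : nat) (Delta alpha : R) (x : int * int) :
  square_fractions Q Delta alpha x ->
  Q%:R < x.1%:~R :> R /\ x.1%:~R <= 2 * Q%:R :> R.
Proof.
move=> [/andP[h1 h2] _ _]; split; first by rewrite -[ltLHS]/(Q%:Z%:~R) ltr_int.
have -> : 2 * Q%:R = (2 * Q%:Z)%:~R :> R by rewrite intrM.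
by rewrite ler_int.
Qed.

Lemma num_close (R : realType) (Q : nat) (Delta alpha : R) (x : int * int) :
  (0 < Q)%N -> square_fractions Q Delta alpha x ->
  `|alpha * x.1%:~R ^+ 2 - x.2%:~R| <= 4 * Q%:R ^+ 2 * Delta.
Proof.
move=> Q0 xs; have [_ _ close] := xs; have [q1 q2] := den_bounds xs.
have QR : 0 < Q%:R :> R by rewrite ltr0n.
set q : R := x.1%:~R in q1 q2 close *.
have q0 : 0 < q by lra.
have -> : alpha * q ^+ 2 - x.2%:~R = - ((x.2%:~R / q ^+ 2 - alpha) * q ^+ 2).
  by field; rewrite gt_eqF.
rewrite normrN normrM (@ger0_norm _ (q ^+ 2)) ?sqr_ge0//.
have : `|x.2%:~R / q ^+ 2 - alpha| * q ^+ 2 <= Delta * (2 * Q%:R) ^+ 2.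
  apply: ler_pM => //; first exact: sqr_ge0.
  by apply: lerXn2r => //; rewrite nnegrE; lra.
by lra.
Qed.

Lemma den_index (Q : nat) (q : int) : Q%:Z < q <= 2 * Q%:Z ->
  exists2 i, (i < Q)%N & q = (Q.+1 + i)%N%:Z.
Proof.
move=> /andP[h1 h2]; exists (`|q| - Q.+1)%N; lia.
Qed.

(** For each of the [Q] denominators [q] the numerators lie within [eta] of [alpha q^2], and are
    recorded by their offset from its floor. *)
Lemma trivial_count (R : realType) (Q : nat) (Delta alpha : R) (s : seq (int * int)) :
  (0 < Q)%N -> 0 < Delta -> uniq s ->
  (forall x, x \in s -> square_fractions Q Delta alpha x) ->
  (size s)%:R <= Q%:R * (8 * Q%:R ^+ 2 * Delta + 4).
Proof.
move=> Q0 D0 us sP; pose eta := 4 * Q%:R ^+ 2 * Delta.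
have eta0 : 0 <= eta by rewrite !mulr_ge0 ?exprn_ge0// ltW.
pose M := (Num.truncn eta).+1.
have /andP[M1 M2] := truncn_itv eta0.
have : (size s <= Q * (2 * M + 2))%N.
  rewrite -[Q in leqRHS](size_iota 0) -[X in (X * _)%N](size_map (fun i => (Q.+1 + i)%N%:Z)).
  rewrite -size_zseq -(size_allpairs pair).
  apply: (@size_le_inj _ _ (fun x => (x.1, x.2 - Num.floor (alpha * x.1%:~R ^+ 2)))) => //.
    by move=> [q a] [q' a'] _ _ /= [-> /addIr ->].
  move=> x xs; apply: allpairs_f.
    have [/den_index[i iQ ->] _ _] := sP _ xs.
    by apply: (map_f (fun i => (Q.+1 + i)%N%:Z)); rewrite mem_iota.
  have := num_close Q0 (sP _ xs); rewrite -/eta ler_norml => /andP[c1 c2].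
  have /andP[f1 f2] := floor_itv (alpha * x.1%:~R ^+ 2); rewrite intrD in f2.
  rewrite -/M in M2.
  apply: mem_zseq.
    rewrite -(ler_int R) rmorphN/= -[M.+1%:~R]/(M.+1%:R) intrB -natr1; lra.
  rewrite -ltzD1 -(ltr_int R) intrD intrB -[M%:~R]/(M%:R); lra.
rewrite -(ler_nat R) => /le_trans; apply.
rewrite natrM ler_wpM2l// natrD natrM /M -natr1; rewrite /eta in M1 *; lra.
Qed.

(** Two numerators over the same [q] differ by at most [8 Q^2 Delta <= 1/4], hence agree. *)
Lemma den_inj (R : realType) (Q : nat) (Delta alpha : R) (s : seq (int * int)) :
  (0 < Q)%N -> 0 < Delta ->
  (forall x, x \in s -> square_fractions Q Delta alpha x) ->
  32 * Q%:R ^+ 2 * Delta <= 1 -> {in s &, injective fst}.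
Proof.
move=> Q0 D0 sP small [q a] [q' a'] xs ys /= E; rewrite -{}E in ys *; congr (_, _).
have := num_close Q0 (sP _ xs); have := num_close Q0 (sP _ ys); rewrite /=.
set w := alpha * _; rewrite !ler_norml => /andP[a1 a2] /andP[b1 b2].
suff : `|a - a'| < 1 by move=> h; apply/eqP; lia.
rewrite -(ltr_int R) intr_norm intrB ltr_norml; apply/andP; split; lra.
Qed.

(** The difference equals [w / (k r^2)] with an integer [w], and it suffices that [|w| >= r/2]. If
    [b n = m r], then [r] divides [n = w]; otherwise [|w| >= |k| r - n >= |k| r / 2]. *)
Lemma separation (R : realType) (b k : int) (r n : nat) (m : int) :
  k != 0 -> (0 < r)%N -> coprimez b r%:Z -> (0 < n)%N -> (2 * n <= `|k| * r)%N ->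
  (2 * `|k| * r)%N%:R^-1 <=
    `|(b%:~R / r%:R + 1 / (k%:~R * r%:R ^+ 2)) * n%:R - m%:~R| :> R.
Proof.
move=> k0 r0 br n0 nk.
have rR : 0 < r%:R :> R by rewrite ltr0n.
have kR : 0 < `|k%:~R| :> R by rewrite normr_gt0 intr_eq0.
pose w : int := k * r%:Z * (b * n%:Z - m * r%:Z) + n%:Z.
have wr : (r <= 2 * `|w|)%N.
  rewrite /w; have [E|E] := eqVneq (b * n%:Z - m * r%:Z) 0.
    rewrite E mulr0 add0r absz_nat.
    have : (r%:Z %| b * n%:Z)%Z by rewrite (subr0_eq E) dvdz_mull.
    rewrite Gauss_dvdzr; last by rewrite coprimez_sym.
    by rewrite dvdzE/= => /(dvdn_leq n0); lia.
  set y := b * _ - _ in E *.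
  have y1 : (0 < `|y|)%N by rewrite absz_gt0.
  have h : (`|k| * r <= `|(k * r%:Z * y)%R|)%N by rewrite !abszM absz_nat leq_pmulr.
  have k1 : (0 < `|k|)%N by rewrite absz_gt0.
  have : (r <= `|k| * r)%N by rewrite leq_pmull.
  move: h; set z := k * r%:Z * y; lia.
have -> : (b%:~R / r%:R + 1 / (k%:~R * r%:R ^+ 2)) * n%:R - m%:~R =
    w%:~R / (k%:~R * r%:R ^+ 2) :> R.
  rewrite /w intrD !intrM intrB !intrM; field.
  by rewrite intr_eq0 k0 gt_eqF.
rewrite normrM normfV normrM (@ger0_norm _ (r%:R ^+ 2)) ?sqr_ge0//.
rewrite ler_pdivlMr ?mulr_gt0 ?exprn_gt0//.
rewrite !natrM natr_absz intr_norm ler_pdivrMl; last by rewrite !mulr_gt0.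
have : r%:R <= 2 * `|w%:~R| :> R.
  by rewrite -intr_norm -natr_absz -natrM ler_nat.
move/(ler_wpM2l (_ : 0 <= `|k%:~R| * r%:R :> R)) => h.
have := h (ltW (mulr_gt0 kR rR)); lra.
Qed.

(** Both [a / q^2] and [b / r] are in lowest terms, so equal fractions have equal denominators. *)
Lemma exact_fraction (b q a : int) (r : nat) : (0 < r)%N -> 0 < q ->
  coprimez b r%:Z -> coprimez a q -> a * r%:Z = b * q ^+ 2 ->
  q ^+ 2 = r%:Z /\ a = b.
Proof.
move=> r0 q0 br aq E.
have d1 : (q ^+ 2 %| r%:Z)%Z.
  have : (q ^+ 2 %| a * r%:Z)%Z by rewrite E dvdz_mull.
  by rewrite Gauss_dvdzr// coprimez_sym coprimezXr.
have d2 : (r%:Z %| q ^+ 2)%Z.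
  have : (r%:Z %| b * q ^+ 2)%Z by rewrite -E dvdz_mull.
  by rewrite Gauss_dvdzr// coprimez_sym.
have qr : q ^+ 2 = r%:Z.
  have : (`|q ^+ 2| == `|r%:Z|)%N by rewrite eqn_dvd -!dvdzE d1 d2.
  by have := sqr_ge0 q; move=> /[swap] /eqP; lia.
split=> //; have r0' : r%:Z != 0 by lia.
by move: E; rewrite qr => /(mulIf r0').
Qed.

(** Square roots of a given residue modulo [r] are sorted by a divisor [d] of [r]: [r] divides
    [(q - q0)(q + q0)], and [r / d] is coprime to [(q - q0) / d]. *)
Lemma sqr_congruence_split (q q0 : int) (r : nat) (d := gcdn `|q - q0| r) :
  (0 < r)%N -> (r%:Z %| q ^+ 2 - q0 ^+ 2)%Z ->
  [/\ (d%:Z %| q - q0)%Z, ((r %/ d)%N%:Z %| q + q0)%Z & (d %| r)%N].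
Proof.
move=> r0 rq; have dr : (d %| r)%N by exact: dvdn_gcdr.
have d0 : (0 < d)%N by rewrite gcdn_gt0 r0 orbT.
split => //; first by rewrite dvdzE/= dvdn_gcdl.
have h : (r %| `|(q - q0)%R| * `|(q + q0)%R|)%N.
  have E : q ^+ 2 - q0 ^+ 2 = (q - q0) * (q + q0) by ring.
  by rewrite E dvdzE abszM in rq.
have cop : coprime (r %/ d) (`|(q - q0)%R| %/ d).
  rewrite /coprime -(eqn_pmul2r d0) muln_gcdl mul1n gcdnC.
  by rewrite !divnK ?dvdn_gcdl ?dvdn_gcdr.
rewrite dvdzE/= -(Gauss_dvdr _ cop) -(dvdn_pmul2r d0) divnK//.
by rewrite mulnAC divnK ?dvdn_gcdl.
Qed.

(** [g] divides the sum and the difference of [q1] and [q], hence [2 q]; and [g^2] divides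
    [d (r / d) = r]. *)
Lemma sqr_gcd_dvd (b a q : int) (r d : nat) (q1 : int)
    (g := gcdn d (r %/ d)) :
  (d %| r)%N -> (d%:Z %| q1 - q)%Z -> ((r %/ d)%N%:Z %| q1 + q)%Z ->
  ((g ^ 2)%N%:Z %| 4 * (a * r%:Z - b * q ^+ 2))%Z.
Proof.
move=> dr h1 h2.
have g1 : (g%:Z %| q1 - q)%Z by apply: dvdz_trans h1; rewrite dvdzE/= dvdn_gcdl.
have g2 : (g%:Z %| q1 + q)%Z by apply: dvdz_trans h2; rewrite dvdzE/= dvdn_gcdr.
have gq : (g%:Z %| 2 * q)%Z.
  have -> : 2 * q = (q1 + q) - (q1 - q) by ring.
  exact: rpredB.
have gr : ((g ^ 2)%N%:Z %| r%:Z)%Z.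
  by rewrite dvdzE/= -(divnK dr) mulnC -mulnn dvdn_mul ?dvdn_gcdl ?dvdn_gcdr.
have gqq : ((g ^ 2)%N%:Z %| (2 * q) ^+ 2)%Z.
  by rewrite -mulnn PoszM expr2 dvdz_mul.
have -> : 4 * (a * r%:Z - b * q ^+ 2) = (4 * a) * r%:Z - b * (2 * q) ^+ 2 by ring.
by rewrite rpredB// dvdz_mull.
Qed.

(* Elements with the same [ell] are congruent modulo [lcm(d, r / d) = r / g]; the
   factor [g] lost there is regained from [g^2 | 4 ell]. *)
Lemma class_count (s : seq (int * int)) (b : int) (q0 : int -> int) (r d M W : nat)
    (ell := fun x : int * int => (x.2 * r%:Z - b * x.1 ^+ 2 : int))
    (g := gcdn d (r %/ d)) :
  uniq s -> (0 < r)%N -> (d %| r)%N -> (r <= W)%N ->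
  (forall x, x \in s -> [/\ ell x != 0, (`|(4 * ell x)%R| <= M)%N,
     ((g ^ 2)%N%:Z %| 4 * ell x)%Z & (`|(x.1 - q0 (ell x))%R| <= W)%N]) ->
  (forall x, x \in s -> (d%:Z %| x.1 - q0 (ell x))%Z /\
     ((r %/ d)%N%:Z %| x.1 + q0 (ell x))%Z) ->
  (r * size s <= 8 * M * W)%N.
Proof.
move=> us r0 dr rW sP sD; pose e := lcmn d (r %/ d).
have d0 : (0 < d)%N by apply: dvdn_gt0 dr.
have rd0 : (0 < r %/ d)%N by rewrite divn_gt0// dvdn_leq.
have g0 : (0 < g)%N by rewrite gcdn_gt0 d0.
have e0 : (0 < e)%N by rewrite lcmn_gt0 d0.
have eg : (e * g = r)%N by rewrite muln_lcm_gcd mulnC divnK.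
have G0 : (g ^ 2)%N%:Z != 0 by rewrite eqz_nat -lt0n expn_gt0 g0.
(* The first factor counts the nonzero multiples [4 ell] of [g^2] up to [M]. The second counts the
   [q] of one residue class modulo [e] within [W] of [q0]. *)
have key : (size s <= 2 * (M %/ g ^ 2) * (2 * (W %/ e) + 2))%N.
  rewrite -size_nzseq -size_zseq -(size_allpairs pair).
  apply: (@size_le_inj _ _ (fun x => (((4 * ell x) %/ (g ^ 2)%N%:Z)%Z,
     ((x.1 - q0 (ell x)) %/ e%:Z)%Z))) => //.
    move=> x y xs ys [E1 E2].
    have [_ _ gx _] := sP _ xs; have [_ _ gy _] := sP _ ys.
    have Exy : ell x = ell y.
      suff : 4 * ell x = 4 * ell y by lia.
      by rewrite -(divzK gx) E1 divzK.
    rewrite Exy in E2.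
    have [dx1 dx2] := sD _ xs; have [dy1 dy2] := sD _ ys; rewrite Exy in dx1 dx2.
    have exy : (e%:Z %| x.1 - y.1)%Z.
      rewrite dvdzE/= dvdn_lcm; apply/andP; split.
        have -> : x.1 - y.1 = (x.1 - q0 (ell y)) - (y.1 - q0 (ell y)) by ring.
        exact: (rpredB dx1 dy1).
      have -> : x.1 - y.1 = (x.1 + q0 (ell y)) - (y.1 + q0 (ell y)) by ring.
      exact: (rpredB dx2 dy2).
    have E3 : x.1 - q0 (ell y) = y.1 - q0 (ell y).
      rewrite (divz_eq (x.1 - q0 (ell y)) e%:Z) [RHS](divz_eq _ e%:Z) E2; congr (_ + _).
      apply/eqP; rewrite eqz_mod_dvd.
      by have -> : x.1 - q0 (ell y) - (y.1 - q0 (ell y)) = x.1 - y.1 by ring.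
    have Eq : x.1 = y.1 by move/addIr: E3.
    case: x y Eq Exy {xs ys E1 E2 gx gy dx1 dx2 dy1 dy2 exy E3} => [q a] [q' a'] /= <-.
    rewrite /ell/= => /addIr /mulIf -> //; lia.
  move=> x xs; have [x0 xM gx xW] := sP _ xs; apply: allpairs_f.
    apply: mem_nzseq.
      by apply: contra x0 => /eqP h; have := divzK gx; rewrite h mul0r; lia.
    have := congr1 absz (divzK gx); rewrite abszM absz_nat => h.
    by rewrite leq_divRL ?expn_gt0 ?g0// h.
  set y := x.1 - _ in xW *.
  have We := divn_eq W e; have We2 := ltn_pmod W e0.
  have ez : 0 < e%:Z by lia.
  apply: mem_zseq.
    rewrite lez_divRL// mulNr -PoszM mulSn; lia.
  rewrite -ltzD1 ltz_divLR// mulrDl mul1r -PoszM; lia.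
(* As [e <= r <= W], the additive 2 in [key] is absorbed by doubling. *)
have W1 : (0 < W %/ e)%N.
  rewrite divn_gt0//; apply: leq_trans rW.
  by rewrite -eg leq_pmulr.
have k1 : (size s <= 8 * (M %/ g ^ 2) * (W %/ e))%N.
  apply: leq_trans key _; move: (M %/ g ^ 2)%N (W %/ e)%N W1 => u v v0.
  have : (u <= u * v)%N by rewrite leq_pmulr.
  nia.
have k2 : ((M %/ g ^ 2) * g <= M)%N.
  apply: leq_trans (leq_divM M (g ^ 2)); rewrite leq_mul2l -mulnn leq_pmulr ?orbT//.
have k3 : ((W %/ e) * e <= W)%N by exact: leq_divM.
rewrite -eg; apply: leq_trans (leq_mul (leqnn _) k1) _.
have -> : (e * g * (8 * (M %/ g ^ 2) * (W %/ e)) =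
  8 * ((M %/ g ^ 2) * g) * ((W %/ e) * e))%N by lia.
by rewrite leq_mul// leq_mul2l k2.
Qed.

(** Elements sharing [ell] have [b q^2] congruent modulo [r], hence [q^2] congruent. They are
    compared with one representative [q0] and split by [d]; each divisor [d] of [r] is handled by
    [class_count]. *)
Lemma rational_part_count (s : seq (int * int)) (b : int) (r M W : nat)
    (ell := fun x : int * int => (x.2 * r%:Z - b * x.1 ^+ 2 : int)) :
  uniq s -> (0 < r)%N -> coprimez b r%:Z -> (r <= W)%N ->
  (forall x, x \in s -> [/\ 0 < x.1, coprimez x.2 x.1 & (`|(4 * ell x)%R| <= M)%N]) ->
  (forall x y, x \in s -> y \in s -> ell x = ell y -> (`|(x.1 - y.1)%R| <= W)%N) ->
  (r * size s <= r + size (divisors r) * (8 * M * W))%N.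
Proof.
move=> us r0 br rW sP sW.
(* The denominator of the first element of [s] with this [ell]; the default [(0, 0)] is never
   reached for values taken on [s]. *)
pose q0 (l : int) : int := (nth (0, 0) s (find (fun x => ell x == l) s)).1.
have q0P x : x \in s -> exists2 y, y \in s & ell y = ell x /\ q0 (ell x) = y.1.
  move=> xs; have hx : has (fun y => ell y == ell x) s by apply/hasP; exists x.
  exists (nth (0, 0) s (find (fun y => ell y == ell x) s)).
    by rewrite mem_nth// -has_find.
  by split => //; apply/eqP; exact: (nth_find (0, 0) hx).
pose s0 := [seq x <- s | ell x == 0]; pose s1 := [seq x <- s | ell x != 0].
have -> : size s = (size s0 + size s1)%N by rewrite !size_filter count_predC.
rewrite mulnDr; apply: leq_add.
  (* The value [ell = 0] forces [q^2 = r] and [a = b], so it accounts for at most one element. *)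
  rewrite -[leqRHS]muln1 leq_mul2l; apply/orP; right.
  apply: (@size_le_inj _ _ (fun=> tt) s0 [:: tt]) => //; first exact: filter_uniq.
  move=> [q a] [q' a']; rewrite !mem_filter => /andP[/eqP e1 xs] /andP[/eqP e2 ys] _.
  have [q0' c _] := sP _ xs; have [q0'' c' _] := sP _ ys.
  have [E1 E3] := exact_fraction r0 q0' br c (subr0_eq e1).
  have [E2 E4] := exact_fraction r0 q0'' br c' (subr0_eq e2).
  rewrite /= in q0' q0'' E1 E2 E3 E4; rewrite E3 E4; congr (_, _).
  by apply/eqP; rewrite -(@eqrXn2 _ 2) ?ltW// E1 E2.
pose f (x : int * int) := gcdn `|(x.1 - q0 (ell x))%R| r.
have dvd x : x \in s -> (r%:Z %| x.1 ^+ 2 - q0 (ell x) ^+ 2)%Z.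
  move=> /q0P[y ys [exy ->]].
  have : (r%:Z %| b * (x.1 ^+ 2 - y.1 ^+ 2))%Z.
    have -> : b * (x.1 ^+ 2 - y.1 ^+ 2) = (x.2 - y.2) * r%:Z + (ell y - ell x).
      by rewrite /ell; ring.
    by rewrite exy subrr addr0 dvdz_mull.
  by rewrite Gauss_dvdzr// coprimez_sym.
apply: leq_trans (leq_mul (leqnn r) (@size_le_sum_fibres _ _ f s1 (divisors r) _)) _.
  by move=> x _; rewrite -dvdn_divisors// dvdn_gcdr.
rewrite big_distrr/= -sum1_size big_distrl/= !big_seq.
apply: leq_sum => d; rewrite -dvdn_divisors// mul1n => dr.
apply: (@class_count _ b q0 r d) => //; first by rewrite !filter_uniq.
  move=> x; rewrite !mem_filter => /andP[/eqP fx /andP[x0 xs]].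
  have [_ _ xM] := sP _ xs; have [y ys [exy qy]] := q0P _ xs.
  have [h1 h2 _] := sqr_congruence_split r0 (dvd _ xs).
  rewrite -/(f x) fx in h1 h2.
  split => //.
    rewrite -/(ell x) -exy; apply: (sqr_gcd_dvd _ _ dr (q1 := x.1)); by rewrite -qy.
  by rewrite -/(ell x) qy; apply: sW.
move=> x; rewrite !mem_filter => /andP[/eqP fx /andP[x0 xs]].
have [h1 h2 _] := sqr_congruence_split r0 (dvd _ xs).
by rewrite -/(f x) fx in h1 h2.
Qed.

(** * The arithmetic and the analytic range *)

Lemma nat_le_truncn (R : realType) (n : nat) (x : R) : n%:R <= x -> (n <= Num.truncn x)%N.
Proof.
move=> nx; rewrite -ltnS -(ltr_nat R); apply: le_lt_trans nx _; exact: truncnS_gt.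
Qed.

(** [ell] stays within [E] of [q^2 / (k r)], hence has size at most [Lm]. If two elements share
    [ell], then [|q^2 - q'^2| <= 2 E v], and [q + q' >= 2 Q] gives [|q - q'| <= Wr]. *)
Lemma small_frequency_count (R : realType) (Q r : nat) (b k : int) (Delta : R)
    (s : seq (int * int)) (v := (`|k| * r)%N) :
  (0 < Q)%N -> 0 < Delta -> (0 < r)%N -> k != 0 -> coprimez b r%:Z -> uniq s ->
  (forall x, x \in s ->
     square_fractions Q Delta (b%:~R / r%:R + 1 / (k%:~R * r%:R ^+ 2)) x) ->
  1 <= Q%:R * Delta * v%:R -> Delta * v%:R * r%:R <= 2 ->
  (size s)%:R <= 1 + 1536 * (size (divisors r))%:R * (Q%:R ^+ 3 * Delta).
Proof.
move=> Q0 D0 r0 k0 br us sP large vr.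
have QR : 0 < Q%:R :> R by rewrite ltr0n.
have rR : 0 < r%:R :> R by rewrite ltr0n.
have v0 : (0 < v)%N by rewrite muln_gt0 absz_gt0 k0.
have vR : 0 < v%:R :> R by rewrite ltr0n.
have vE : v%:R = `|k%:~R * r%:R| :> R.
  by rewrite normrM -intr_norm /v natrM natr_absz intr_norm (@ger0_norm _ r%:R).
set alpha := _ + _ in sP.
pose ell := fun x : int * int => (x.2 * r%:Z - b * x.1 ^+ 2 : int).
pose E : R := 4 * Q%:R ^+ 2 * Delta * r%:R.
pose Lm : R := 4 * Q%:R ^+ 2 / v%:R + E.
pose Wr : R := 4 * Q%:R * Delta * r%:R * v%:R.
have E0 : 0 <= E by rewrite /E !mulr_ge0 ?exprn_ge0// ltW.
have Lm0 : 0 <= Lm by rewrite addr_ge0// divr_ge0// mulr_ge0// exprn_ge0.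
have Wr0 : 0 <= Wr by rewrite /Wr !mulr_ge0// ltW.
have kr0 : k%:~R * r%:R != 0 :> R by rewrite mulf_neq0 ?intr_eq0// gt_eqF.
have close x : x \in s -> `|(ell x)%:~R - x.1%:~R ^+ 2 / (k%:~R * r%:R)| <= E.
  move=> xs; have := num_close Q0 (sP _ xs).
  move/(ler_wpM2r (ltW rR)); rewrite -/E; apply: le_trans.
  rewrite -[X in _ <= _ * X](ger0_norm (ltW rR)) -normrM -normrN.
  rewrite le_eqVlt; apply/orP; left; apply/eqP; congr `|_|.
  rewrite /ell /alpha intrB !intrM; field.
  by rewrite intr_eq0 k0 gt_eqF.
have : (r * size s <= r + size (divisors r) *
    (8 * Num.truncn (4 * Lm)%R * Num.truncn Wr))%N.
  apply: (@rational_part_count s b) => //.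
  (* The hypothesis [Q Delta v >= 1] makes the interval of admissible [q] at least as long as the
     modulus: [Wr >= 4 r]. *)
  - by apply: nat_le_truncn; rewrite /Wr; have := ler_wpM2r (ltW rR) large; lra.
  - move=> x xs; have [/andP[q1 _] c _] := sP _ xs; split => //.
      by apply: le_lt_trans q1.
    apply: nat_le_truncn; rewrite natr_absz -/(ell x) intr_norm intrM normrM ger0_norm//.
    rewrite ler_wpM2l//.
    have [d1 d2] := den_bounds (sP _ xs).
    rewrite -[X in `|X|](subrK (x.1%:~R ^+ 2 / (k%:~R * r%:R))) addrC.
    apply: le_trans (ler_normD _ _) _; apply: lerD; last exact: close.
    rewrite normrM normfV -vE ger0_norm ?sqr_ge0// ler_wpM2r ?invr_ge0//.
    have -> : 4 * Q%:R ^+ 2 = (2 * Q%:R) ^+ 2 :> R by ring.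
    by apply: lerXn2r; rewrite // nnegrE; lra.
  - move=> x y xs ys exy; apply: nat_le_truncn; rewrite natr_absz intr_norm intrB.
    have [d1 d2] := den_bounds (sP _ xs); have [d3 d4] := den_bounds (sP _ ys).
    have c1 := close _ xs; have c2 := close _ ys.
    rewrite -/(ell x) -/(ell y) in exy; rewrite exy in c1.
    set q : R := x.1%:~R in d1 d2 c1 *; set q' : R := y.1%:~R in d3 d4 c2 *.
    set l : R := _%:~R in c1 c2.
    have : `|q ^+ 2 / (k%:~R * r%:R) - q' ^+ 2 / (k%:~R * r%:R)| <= E + E.
      have -> : q ^+ 2 / (k%:~R * r%:R) - q' ^+ 2 / (k%:~R * r%:R) =
         (l - q' ^+ 2 / (k%:~R * r%:R)) - (l - q ^+ 2 / (k%:~R * r%:R)) by ring.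
      by apply: le_trans (ler_normB _ _) _; apply: lerD.
    rewrite -mulrBl normrM normfV -vE ler_pdivrMr//.
    have -> : q ^+ 2 - q' ^+ 2 = (q - q') * (q + q') by ring.
    rewrite normrM (@ger0_norm _ (q + q')); last by lra.
    have : `|q - q'| * (2 * Q%:R) <= `|q - q'| * (q + q') by rewrite ler_wpM2l//; lra.
    move=> h1 h2; rewrite -(ler_pM2r (_ : 0 < 2 * Q%:R)) ?mulr_gt0//.
    by apply: le_trans h1 (le_trans h2 _); rewrite /E /Wr; lra.
set M := Num.truncn _; set W := Num.truncn _.
rewrite -(ler_nat R) natrD !natrM => h.
have Lm4 : 0 <= 4 * Lm by rewrite mulr_ge0.
have M1 : M%:R <= 4 * Lm by have /andP[] := truncn_itv Lm4.
have W1 : W%:R <= Wr by have /andP[] := truncn_itv Wr0.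
have MW : M%:R * W%:R <= 4 * Lm * Wr by apply: ler_pM.
have tau0 : 0 <= (size (divisors r))%:R :> R by [].
rewrite -(ler_pM2l rR); apply: le_trans h _.
(* Here [Delta v r <= 2] bounds the factor [1 + Delta v r] by 3; then [8 * 192 = 1536]. *)
have h1 : 4 * Lm * Wr <= r%:R * (192 * (Q%:R ^+ 3 * Delta)).
  have -> : 4 * Lm * Wr = r%:R * (64 * (Q%:R ^+ 3 * Delta) * (1 + Delta * v%:R * r%:R)).
    by rewrite /Lm /Wr /E; field; rewrite gt_eqF.
  rewrite ler_pM2l//.
  have -> : 192 * (Q%:R ^+ 3 * Delta) = 64 * (Q%:R ^+ 3 * Delta) * 3 :> R by ring.
  rewrite ler_wpM2l ?mulr_ge0 ?exprn_ge0 ?(ltW D0)//; lra.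
have := ler_wpM2l tau0 (le_trans MW h1); lra.
Qed.

(** [weyl_count] is applied with [H] about [1 / (32 Q^2 Delta)], blocks of about [v / 2] points and
    separation [1 / (2 v)]. *)
Lemma large_frequency_count (R : realType) (eps C1 : R) (Q r : nat) (b k : int)
    (Delta : R) (s : seq (int * int)) (v := (`|k| * r)%N) (X := Q%:R / Delta) :
  0 < eps -> 0 < C1 ->
  (forall n, (0 < n)%N -> (size (divisors n))%:R <= C1 * n%:R `^ eps) ->
  (0 < Q)%N -> 0 < Delta -> (0 < r)%N -> k != 0 -> coprimez b r%:Z -> uniq s ->
  (forall x, x \in s ->
     square_fractions Q Delta (b%:~R / r%:R + 1 / (k%:~R * r%:R ^+ 2)) x) ->
  32 * Q%:R ^+ 2 * Delta <= 1 -> Q%:R * Delta * v%:R < 1 -> (Q <= v)%N ->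
  (size s)%:R <= 256 * (Q%:R ^+ 3 * Delta) +
    8 * Num.sqrt (1 + 1112 * (C1 * 2 `^ eps) * ((1 + eps^-1) * 2 `^ eps)) *
      X `^ eps * Num.sqrt Q%:R.
Proof.
move=> e0 C10 tau Q0 D0 r0 k0 br us sP small vsmall Qv.
have QR : 0 < Q%:R :> R by rewrite ltr0n.
have QR1 : 1 <= Q%:R :> R by rewrite ler1n.
have v0 : (0 < v)%N by rewrite muln_gt0 absz_gt0 k0.
have vR : 0 < v%:R :> R by rewrite ltr0n.
have vR1 : 1 <= v%:R :> R by rewrite ler1n.
have QvR : Q%:R <= v%:R :> R by rewrite ler_nat.
set alpha := _ + _ in sP.
(* With 32 = 8 * 4, [num_close] bounds the distance of [alpha q^2] from an integer by [u / 8], so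
   [H u <= 1] is what [fejer_count] asks for. *)
pose u : R := 32 * Q%:R ^+ 2 * Delta.
have u0 : 0 < u by rewrite /u !mulr_gt0// exprn_gt0.
pose H := Num.truncn u^-1.
have ui0 : 0 <= u^-1 by rewrite invr_ge0 ltW.
have H0 : (0 < H)%N by apply: nat_le_truncn; rewrite invf_ge1.
have HR : 0 < H%:R :> R by rewrite ltr0n.
have HR1 : 1 <= H%:R :> R by rewrite ler1n.
have [H1 H2] : H%:R <= u^-1 /\ u^-1 < H.+1%:R by have /andP[] := truncn_itv ui0.
have Hu : H%:R * u <= 1 by rewrite -ler_pdivlMr// div1r.
have Hinv : H%:R^-1 <= 2 * u.
  rewrite -natr1 in H2.
  rewrite -[leLHS]mul1r ler_pdivrMr//.
  have : 1 < (H%:R + 1) * u by rewrite -ltr_pdivrMr// div1r.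
  by have : u <= H%:R * u; [rewrite ler_pMl//|lra].
(* Every [0 < n < L] satisfies [2 n <= v], as [separation] requires; [T] blocks cover all [n] below
   [2 H Q]. *)
pose L := (v %/ 2).+1; pose T := ((2 * H * Q) %/ L).+1.
have HQT : (2 * H * Q <= T * L)%N by apply/ltnW; rewrite ltn_ceil.
have X0 : 0 < X by rewrite divr_gt0.
have vX : v%:R <= X.
  rewrite ler_pdivlMr//; apply: le_trans (_ : 1 <= _) => //.
  apply: le_trans (ltW vsmall).
  by rewrite -mulrA [Delta * _]mulrC ler_peMl// mulr_ge0// ltW.
have HQX : (2 * H * Q)%N%:R <= X.
  rewrite ler_pdivlMr// !natrM.
  have h1 : Q%:R * (H%:R * Delta) <= Q%:R * Q%:R * (H%:R * Delta).
    by rewrite ler_wpM2r ?ler_peMl// mulr_ge0// ltW.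
  have h2 : 0 <= Q%:R * (H%:R * Delta) by rewrite !mulr_ge0// ltW.
  by move: Hu h1 h2 QR1; rewrite /u; clear; lra.
have X20 : 0 <= 2 * X by rewrite mulr_ge0// ltW.
have Xe0 : 0 <= X `^ eps by exact: powR_ge0.
have two_e : (2 * X) `^ eps = 2 `^ eps * X `^ eps by rewrite powRM// ltW.
pose D : R := C1 * (2 `^ eps * X `^ eps).
have D_ge0 : 0 <= D by rewrite /D !mulr_ge0 ?powR_ge0// ltW.
have tauD n : (0 < n < T * L)%N -> (size (divisors n))%:R <= D.
  move=> /andP[n0 nTL]; apply: le_trans (tau _ n0) _.
  rewrite /D -two_e ler_wpM2l ?(ltW C10)//.
  apply: ge0_ler_powR; rewrite ?nnegrE ?(ltW e0)//.
  (* The blocks overshoot [2 H Q] by at most one block, so every argument of the divisor bound is at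
     most [2 X]. *)
  have : (n <= 2 * H * Q + v)%N.
    move: nTL; rewrite /T mulSn {1}/L addSn ltnS => /leq_trans; apply.
    by rewrite addnC leq_add ?leq_divM ?leq_div.
  rewrite -(ler_nat R) natrD => h; apply: le_trans h _.
  by move: HQX vX; clear; lra.
pose B := (2 * `|k| * r)%N.
have Bv : B = (2 * v)%N by rewrite /B /v mulnA.
have B0 : (0 < B)%N by rewrite Bv muln_gt0.
pose I : {set 'I_Q} := [set i : 'I_Q | has (fun x => x.1 == (Q.+1 + i)%N%:Z) s]%SET.
have sI : (size s <= #|I|)%N.
  rewrite cardE -(size_map (fun i : 'I_Q => (Q.+1 + i)%N%:Z)).
  apply: (@size_le_inj _ _ fst) => //; first exact: (den_inj Q0 D0 sP small).
  move=> x xs; have [/den_index[i iQ xi] _ _] := sP _ xs.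
  rewrite xi; apply: (map_f (fun i : 'I_Q => (Q.+1 + i)%N%:Z) (x := Ordinal iQ)).
  by rewrite mem_enum inE; apply/hasP; exists x => //=; apply/eqP.
have near i : i \in I -> exists a : int,
     H%:R * `|alpha * (Q.+1 + i)%:R ^+ 2 - a%:~R| <= 1 / 8.
  rewrite inE => /hasP[x xs /eqP xi]; exists x.2.
  have := num_close Q0 (sP _ xs); rewrite xi.
  move=> /(ler_wpM2l (ltW HR)) h; apply: le_trans h _.
  by move: Hu; rewrite /u; clear; lra.
have sep n (m : int) : (0 < n < L)%N -> B%:R^-1 <= `|alpha * n%:R - m%:~R|.
  move=> /andP[n0 nL]; apply: separation => //.
  by move: nL; rewrite /L ltnS leq_divRL// mulnC.
have := weyl_count H0 B0 Q0 near sep HQT tauD D_ge0.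
move=> W; apply: le_trans (_ : #|I|%:R <= _); first by rewrite ler_nat.
apply: le_trans W _; apply: lerD.
  apply: le_trans (_ : 4 * Q%:R * (2 * u) <= _).
    by rewrite ler_wpM2l// mulr_ge0.
  by rewrite /u le_eqVlt; apply/orP; left; apply/eqP; ring.
set K : R := (1 + eps^-1) * 2 `^ eps.
set c : R := 1 + _ * K.
have K0 : 0 <= K by rewrite mulr_ge0 ?powR_ge0// addr_ge0// invr_ge0 ltW.
pose l : R := 1 + ln B%:R.
have BR1 : 1 <= B%:R :> R by rewrite ler1n.
have l1 : 1 <= l by rewrite lerDl ln_ge0.
have lK : l <= K * X `^ eps.
  apply: le_trans (one_plus_ln_le_powR e0 BR1) _.
  rewrite /K -mulrA -two_e ler_wpM2l//; first by rewrite addr_ge0// invr_ge0 ltW.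
  apply: ge0_ler_powR; rewrite ?nnegrE ?(ltW e0)//.
  by rewrite Bv natrM ler_wpM2l.
(* The first term comes from the number of full blocks, the second from the extra one through
   [1 / H <= 2 u]. *)
have TH : T%:R / H%:R <= 4 * Q%:R / v%:R + 2 * u.
  have TL : ((T.-1) * L <= 2 * H * Q)%N by exact: leq_divM.
  have Lv : v%:R / 2 <= L%:R :> R.
    by rewrite ler_pdivrMr// -natrM ler_nat ltnW// ltn_ceil.
  have T1 : T%:R <= 4 * H%:R * Q%:R / v%:R + 1 :> R.
        apply: le_trans (_ : T.-1%:R + 1 <= _); first by rewrite natr1.
    rewrite lerD2r ler_pdivlMr//.
    have : T.-1%:R * L%:R <= 2 * H%:R * Q%:R :> R by rewrite -!natrM ler_nat.
    have := ler_wpM2l (ler0n R T.-1) Lv; clear; lra.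
  rewrite ler_pdivrMr//; apply: le_trans T1 _.
  have -> : (4 * Q%:R / v%:R + 2 * u) * H%:R =
      4 * H%:R * Q%:R / v%:R + H%:R * (2 * u) by ring.
  by rewrite lerD2l -ler_pdivrMl// mulr1.
have M0 : 0 <= 2 * Q%:R + 8 * v%:R :> R by rewrite addr_ge0// mulr_ge0.
have main : T%:R / H%:R * (2 * Q%:R + 4 * B%:R * l) <= 556 * (l * Q%:R).
  apply: le_trans (_ : (4 * Q%:R / v%:R + 2 * u) * ((2 * Q%:R + 8 * v%:R) * l) <= _).
    apply: ler_pM => //.
    - have l0 := le_trans ler01 l1.
      by apply: addr_ge0; [apply: mulr_ge0|apply: mulr_ge0 => //; apply: mulr_ge0].
    - have -> : (2 * Q%:R + 8 * v%:R) * l = 2 * Q%:R * l + 4 * (2 * v%:R) * l by ring.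
      rewrite Bv natrM lerD2r ler_peMr// mulr_ge0//.
  have -> : 556 * (l * Q%:R) = 556 * Q%:R * l :> R by ring.
  rewrite [X in X <= _]mulrA; apply: ler_wpM2r; first exact: le_trans ler01 l1.
  (* By [Q <= v], [u <= 1] and [Q Delta v < 1] the terms add up to at most
     [(8 + 32 + 4 + 512) Q = 556 Q]. *)
  have -> : (4 * Q%:R / v%:R + 2 * u) * (2 * Q%:R + 8 * v%:R) =
     8 * (Q%:R * Q%:R / v%:R) + 32 * Q%:R + 4 * (u * Q%:R) +
     512 * (Q%:R * (Q%:R * Delta * v%:R)).
    by rewrite /u; field; rewrite gt_eqF.
  have h1 : Q%:R * Q%:R / v%:R <= Q%:R :> R by rewrite ler_pdivrMr// ler_wpM2l.
  have h2 : u * Q%:R <= 1 * Q%:R by rewrite ler_wpM2r.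
  have h3 : Q%:R * (Q%:R * Delta * v%:R) <= Q%:R * 1 by rewrite ler_wpM2l// ltW.
  by move: h1 h2 h3; clear; lra.
have Y1 : 1 <= X `^ eps.
  by rewrite -(powRr0 X) ler_powR ?(ltW e0)//; apply: le_trans vX.
have P2 : 0 <= 2 `^ eps :> R by exact: powR_ge0.
have CK0 : 0 <= C1 * 2 `^ eps * K.
  by apply: mulr_ge0 => //; apply: mulr_ge0 => //; exact: ltW.
have c0 : 0 <= c.
  have -> : c = 1 + 1112 * (C1 * 2 `^ eps * K) by rewrite /c; ring.
  exact: (addr_ge0 ler01 (mulr_ge0 (ler0n R 1112) CK0)).
(* The divisor bound and the logarithm each cost [X^eps]; under the square root they leave a single
   [X^eps]. *)
have -> : 8 * Num.sqrt c * X `^ eps * Num.sqrt Q%:R =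
    8 * Num.sqrt (c * (X `^ eps) ^+ 2 * Q%:R).
  rewrite sqrtrM; last by apply: mulr_ge0 => //; exact: sqr_ge0.
  by rewrite sqrtrM// sqrtr_sqr (ger0_norm Xe0) !mulrA.
apply: ler_wpM2l => //; apply: ler_wsqrtr.
have -> : 2 * D * T%:R * (2 * Q%:R + 4 * B%:R * l) / H%:R =
    2 * D * (T%:R / H%:R * (2 * Q%:R + 4 * B%:R * l)) by ring.
have D2 : 0 <= 2 * D by apply: mulr_ge0.
apply: le_trans (_ : Q%:R + 2 * D * (556 * (K * X `^ eps * Q%:R)) <= _).
  rewrite lerD2l; apply: ler_wpM2l => //; apply: le_trans main _.
  exact: (ler_wpM2l (ler0n R 556) (ler_wpM2r (ltW QR) lK)).
have -> : Q%:R + 2 * D * (556 * (K * X `^ eps * Q%:R)) =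
    (1 + 1112 * (C1 * 2 `^ eps * K) * (X `^ eps) ^+ 2) * Q%:R :> R.
  by rewrite /D; ring.
apply: ler_wpM2r => //.
have -> : c * (X `^ eps) ^+ 2 = (X `^ eps) ^+ 2 + 1112 * (C1 * 2 `^ eps * K) * (X `^ eps) ^+ 2.
  by rewrite /c; ring.
by rewrite lerD2r exprn_ege1.
Qed.


(** * Assembling the ranges *)

Lemma absorb_terms (R : realType) (A Y q Z a c : R) :
  0 <= A -> 1 <= Y -> 1 <= q -> 0 <= Z -> a <= A -> c <= A ->
  a * (Y * q) + c * (Y * Z) <= A * Y * (q + Z).
Proof.
move=> A0 Y1 q1 Z0 aA cA; have Y0 : 0 <= Y by lra.
have q0 : 0 <= q by lra.
rewrite mulrDr -!mulrA; apply: lerD; apply: ler_wpM2r => //; exact: mulr_ge0.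
Qed.

(** The size conditions on [|k|] are recast without ceilings as bounds for [v = |k| r]. The three
    ranges then share one constant, which depends on [eps] through [C1] and [S]. *)
Lemma theorem_core (R : realType) (eps : R) : 0 < eps ->
  exists2 C : R, 0 < C &
    forall (Q : nat) (Delta : R) (r : nat) (b k : int),
      (0 < Q)%N -> 0 < Delta -> Delta <= 1 / 2 -> (0 < r)%N ->
      r%:R * Num.sqrt Delta <= 1 -> coprimez b r%:Z ->
      1 <= Num.sqrt Delta * (`|k| * r)%N%:R ->
      Delta * (`|k| * r)%N%:R * r%:R <= 2 ->
      (P_count Q Delta (b%:~R / r%:R + 1 / (k%:~R * r%:R ^+ 2)))%:R <=
      C * (Q%:R / Delta) `^ eps * (Num.sqrt Q%:R + Q%:R ^+ 3 * Delta).
Proof.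
move=> e0; have [C1 C10 tau] := divisor_bound e0.
pose S := Num.sqrt (1 + 1112 * (C1 * 2 `^ eps) * ((1 + eps^-1) * 2 `^ eps)).
have S0 : 0 <= S by exact: sqrtr_ge0.
exists (400 + 1536 * C1 + 8 * S); first lra.
move=> Q Delta r b k Q0 D0 D12 r0 rD br vD kD.
have QR : 0 < Q%:R :> R by rewrite ltr0n.
have rR : 0 < r%:R :> R by rewrite ltr0n.
set alpha := _ + _.
have [s [us <- sP]] := square_fractions_seq Q Delta alpha.
set v := (`|k| * r)%N in vD kD *.
set X := Q%:R / Delta; set Y := X `^ eps; set Z := Q%:R ^+ 3 * Delta.
set q := Num.sqrt Q%:R.
have t0 : 0 < Num.sqrt Delta by rewrite sqrtr_gt0.
have t2 : Num.sqrt Delta ^+ 2 = Delta by rewrite sqr_sqrtr// ltW.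
set t := Num.sqrt Delta in rD vD t0 t2.
have t1 : t <= 1 by rewrite -(@expr_le1 _ 2) ?(ltW t0)// t2; lra.
have Q1 : 1 <= Q%:R :> R by rewrite ler1n.
have q1 : 1 <= q by rewrite -sqrtr1 ler_wsqrtr.
have Z0 : 0 < Z by rewrite mulr_gt0// exprn_gt0.
have rX : r%:R <= X.
  rewrite ler_pdivlMr// -t2; have : r%:R * t * t <= 1 by apply: mulr_ile1; rewrite ?mulr_ge0// ltW.
  by lra.
have X1 : 1 <= X by apply: le_trans rX; rewrite ler1n.
have Y1 : 1 <= Y by rewrite /Y -(powRr0 X) ler_powR// ltW.
have v0 : (0 < v)%N by rewrite lt0n; apply/negP => /eqP v0; move: vD; rewrite v0 mulr0 ler10.
have k0 : k != 0 by apply/negP => /eqP k0; rewrite /v k0 in v0.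
have vR : 0 < v%:R :> R by rewrite ltr0n.
have Y0 : 0 <= Y by exact: le_trans ler01 Y1.
have q0 : 0 <= q by exact: sqrtr_ge0.
have C0 := ltW C10.
set A := 400 + 1536 * C1 + 8 * S.
have SC : 0 <= 8 * S /\ 0 <= 1536 * C1.
  by split; apply: mulr_ge0; rewrite ?ler0n.
have [A0 [A1 [A2 A3]]] : 0 <= A /\ 400 <= A /\ 1536 * C1 <= A /\ 8 * S <= A.
  by move: SC; rewrite /A; clear; lra.
have ZY : Z <= Y * Z by rewrite ler_peMl// ltW.
have Yq : 1 <= Y * q by apply: mulr_ege1.
have absorb a c : a <= A -> c <= A -> _ := absorb_terms A0 Y1 q1 (ltW Z0).
have [small|big] := leP (32 * Q%:R ^+ 2 * Delta) 1; last first.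
  apply: le_trans (trivial_count Q0 D0 us sP) _.
  apply: le_trans (absorb 0 400 A0 A1); rewrite mul0r add0r.
  (* In this range [Q < 32 Z], so the constant number of numerators per denominator is also absorbed
     by [Z]. *)
  have : Q%:R * 1 <= Q%:R * (32 * Q%:R ^+ 2 * Delta) by rewrite ler_wpM2l// ltW.
  have -> : Q%:R * (32 * Q%:R ^+ 2 * Delta) = 32 * Z by rewrite /Z; ring.
  have -> : Q%:R * (8 * Q%:R ^+ 2 * Delta + 4) = 8 * Z + 4 * Q%:R by rewrite /Z; ring.
  by move: ZY Z0; clear; lra.
have [large|vsmall] := leP 1 (Q%:R * Delta * v%:R).
  apply: le_trans (small_frequency_count Q0 D0 r0 k0 br us sP large kD) _.
  have h : (size (divisors r))%:R <= C1 * Y.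
    apply: le_trans (tau _ r0) _; rewrite ler_wpM2l ?(ltW C10)//.
    by apply: ge0_ler_powR; rewrite ?nnegrE ?(ltW e0) ?(le_trans ler01 X1).
  apply: le_trans (absorb 400 (1536 * C1) A1 A2); rewrite -/Z.
  have := ler_wpM2r (ltW Z0) h.
  by move: Yq; clear; lra.
(* Smallness of [Q^2 Delta] gives [Q sqrt Delta <= 1], while [1 <= v sqrt Delta]. *)
have Qv : (Q <= v)%N.
  rewrite -(ler_nat R).
  have Qt : Q%:R * t <= 1.
    rewrite -(@expr_le1 _ 2) ?mulr_ge0 ?(ltW t0)// exprMn t2.
    have : 0 < Q%:R ^+ 2 * Delta by rewrite mulr_gt0// exprn_gt0.
    by move: small; clear; lra.
  rewrite -(ler_pM2l t0) mulrC; exact: le_trans Qt vD.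
apply: le_trans (large_frequency_count e0 C10 tau Q0 D0 r0 k0 br us sP small vsmall Qv) _.
apply: le_trans (absorb (8 * S) 400 A3 A1); rewrite -/S -/X -/Y -/q -/Z.
by move: ZY Z0; clear; lra.
Qed.

Theorem theorem3 (R : realType) (eps : R) (eps_gt0 : 0 < eps) :
  exists2 C : R, 0 < C &
    forall (Q : nat) (Delta tau alpha z : R) (r : nat) (b k : int),
      (0 < Q)%N ->
      0 < Delta -> Delta <= 1 / 2 ->
      tau = Delta `^ (- (1 / 2)) ->
      (0 < r)%N -> r%:R <= tau ->
      coprimez b r%:Z ->
      Num.ceil (r%:R^-1 * Delta `^ (- (1 / 2))) <= `|k| ->
      `|k| <= Num.ceil (r%:R ^- 2 * Delta^-1) ->
      z = 1 / (k%:~R * r%:R ^+ 2) ->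
      alpha = b%:~R / r%:R + z ->
      (P_count Q Delta alpha)%:R <=
        C * (Q%:R / Delta) `^ eps *
        (Q%:R `^ (1 / 2) + Q%:R * Delta `^ (1 / 4) + Q%:R ^+ 3 * Delta
         + Num.sqrt r%:R
         + Q%:R `^ (3 / 2) * Delta `^ (1 / 2) * r%:R `^ (1 / 4)
         + Q%:R ^+ 2 * Delta * r%:R).
Proof.
have [C C0 core] := theorem_core eps_gt0.
exists C => // Q Delta tau alpha z r b k Q0 D0 D12 -> r0 rtau br k1 k2 -> ->.
have rR : 0 < r%:R :> R by rewrite ltr0n.
have t0 : 0 < Num.sqrt Delta by rewrite sqrtr_gt0.
have t2 : Num.sqrt Delta ^+ 2 = Delta by rewrite sqr_sqrtr// ltW.
have half : 1 / 2 = 2^-1 :> R by rewrite div1r.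
have tE : Delta `^ (- (1 / 2)) = (Num.sqrt Delta)^-1.
  by rewrite powRN half powR12_sqrt// ltW.
rewrite tE in rtau k1; set t := Num.sqrt Delta in t0 t2 tE rtau k1.
have rt : r%:R * t <= 1 by rewrite -ler_pdivlMr// div1r.
have vE : (`|k| * r)%N%:R = `|k|%:~R * r%:R :> R by rewrite natrM natr_absz.
rewrite ceil_le_int in k1.
have vt : 1 <= t * (`|k| * r)%N%:R.
  have := ler_wpM2l (ltW (mulr_gt0 t0 rR)) k1.
  have -> : t * r%:R * (r%:R^-1 * t^-1) = 1 by field; rewrite !gt_eqF.
  by rewrite vE -mulrA [r%:R * _]mulrC.
have vD : Delta * (`|k| * r)%N%:R * r%:R <= 2.
  (* The ceiling costs at most 1. After multiplication by [r^2 Delta <= 1] this is the second unit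
     of the bound 2. *)
  have k3 : `|k|%:~R < r%:R ^- 2 * Delta^-1 + 1.
    rewrite -ltrBlDr; apply: le_lt_trans (ceilB1_lt _).
    by rewrite intrB lerD2r ler_int.
  have rD0 : 0 < r%:R ^+ 2 * Delta by rewrite mulr_gt0// exprn_gt0.
  have rD1 : r%:R ^+ 2 * Delta <= 1.
    by rewrite -t2 -exprMn exprn_ile1// mulr_ge0 ?(ltW t0).
  have := ler_wpM2l (ltW rD0) (ltW k3).
  have -> : r%:R ^+ 2 * Delta * (r%:R ^- 2 * Delta^-1 + 1) = 1 + r%:R ^+ 2 * Delta.
    by field; rewrite !gt_eqF.
  have -> : Delta * (`|k| * r)%N%:R * r%:R = r%:R ^+ 2 * Delta * `|k|%:~R.
    by rewrite vE; ring.
  by move=> h; apply: le_trans h _; rewrite -[2]/(1 + 1) lerD2l.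
apply: le_trans (core Q Delta r b k Q0 D0 D12 r0 rt br vt vD) _.
apply: ler_wpM2l; first by rewrite mulr_ge0 ?powR_ge0// ltW.
have D0' := ltW D0.
(* The two terms of [theorem_core] occur in the sum, and the remaining terms are nonnegative. *)
rewrite half powR12_sqrt// -!addrA lerD2l addrCA lerDl.
by rewrite !addr_ge0 ?sqrtr_ge0 ?mulr_ge0 ?powR_ge0 ?exprn_ge0.
Qed.
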